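(* Let $\mathcal{O}$ be a generalised octagon fully embedded in a metasymplectic space $\mathcal{M}$. Then the embedding of $\mathcal{O}$ in $\mathcal{M}$ is pseudo-isometric if, and only if, (S) two points of $\mathcal{O}$ are at distance $2$ (in $\mathcal{O}$) if, and only if, they are symplectic (in $\mathcal{M}$).
   Context: Geometries. A geometry of rank $n$ is a tuple $(V_1,\dots,V_n,C)$ with $V_1,\dots,V_n$ disjoint non-empty sets and $C\subseteq V_1\times\dots\times V_n$ (chambers). Elements of distinct $V_i,V_j$ are incident if they lie in a common chamber. Elements of $V_1$ are points, elements of $V_2$ lines; two points are collinear if some line is incident with both. The geometry is connected if its incidence graph is connected. Its dual is $(V_n,\dots,V_1,C^D)$, chambers being read in reverse order. For $v\in V_i$, the $v$-shadow-geometry (resp. $v$-residue-geometry) consists of the elements of types $1,\dots,i-1$ (resp. $i+1,\dots,n$) incident with $v$, with chambers the corresponding truncations of the chambers containing $v$. Generalised octagon: a rank $2$ geometry of points and lines whose incidence graph has diameter $8$ and girth $16$, and such that for some cardinals $s,t\ge 2$ every point is incident with $t+1$ lines and every line with $s+1$ points. Polar space of rank $3$: a rank $3$ geometry of points, lines and planes (in the usual sense, the lines and planes being the singular subspaces of projective dimension $1$ and $2$, planes being the maximal singular subspaces) such that every line has at least $3$ points, no point is collinear with every other point, and for every point $x$ and line $L$ not incident with $x$, either exactly one or all points of $L$ are collinear to $x$. A dual polar space of rank $3$ is the dual of a polar space of rank $3$. Metasymplectic space: a connected rank $4$ geometry $\mathcal{M}$ of points, lines, planes and symplecta (symps), with at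 least two symps, such that (MS1) for each symp $\Sigma$ the $\Sigma$-shadow-geometry is a polar space of rank $3$; (MS2) for each point $x$ the $x$-residue-geometry is a dual polar space of rank $3$; (MS3) the intersection of two distinct symps is empty, a point, a line or a plane. Lines, planes and symps are identified with their sets of points. Two distinct points $x,y$ of $\mathcal{M}$ satisfy exactly one of: collinear; symplectic (not collinear, and there is a unique symp containing both); special (not collinear, and there is a unique point collinear to both); opposite (no point is collinear to both). The words collinear, symplectic, special, opposite always refer to $\mathcal{M}$. A generalised octagon $\mathcal{O}$ is fully embedded in $\mathcal{M}$ if its points and lines are points and lines of $\mathcal{M}$, incidence in $\mathcal{O}$ is that of $\mathcal{M}$, and for every line of $\mathcal{O}$ all points of $\mathcal{M}$ on it are points of $\mathcal{O}$. The distance of two points of $\mathcal{O}$ is their distance in the collinearity graph of $\mathcal{O}$. The embedding is pseudo-isometric if it is full and two (distinct) points of $\mathcal{O}$ are at distance $1$, $2$, $3$, $4$ if, and only if, they are respectively collinear, symplectic, special, opposite. *)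

(* Defs.v *)
From mathcomp Require Import all_boot.
From mathcomp Require Import mathcomp_extra boolp classical_sets functions.
From mathcomp Require Import cardinality.

Set Implicit Arguments.
Unset Strict Implicit.
Unset Printing Implicit Defensive.

Local Open Scope classical_set_scope.
Local Open Scope card_scope.

Section Graphs.
Variables (T : Type) (V : set T) (R : T -> T -> Prop).

Fixpoint walk (k : nat) (x y : T) : Prop :=
  if k is k'.+1 then exists2 z, R x z & walk k' z y else x = y.

Definition at_distance (k : nat) (x y : T) : Prop :=
  walk k x y /\ forall j, j < k -> ~ walk j x y.

Definition connected_graph : Prop :=
  forall x y, V x -> V y -> exists k, walk k x y.

Definition graph_diameter (d : nat) : Prop :=
  (forall x y, V x -> V y -> exists2 k, k <= d & at_distance k x y) /\
  (exists x y, [/\ V x, V y & at_distance d x y]).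

(* The vertices f 0, ..., f (k - 1) form a circuit of length k. *)
Definition graph_circuit (k : nat) (f : nat -> T) : Prop :=
  [/\ 2 < k,
      forall i, i < k -> V (f i),
      forall i j, i < k -> j < k -> f i = f j -> i = j,
      forall i, i < k -> R (f i) (f i.+1)
    & f k = f 0].

Definition graph_girth (g : nat) : Prop :=
  (exists f, graph_circuit g f) /\ (forall k f, graph_circuit k f -> g <= k).

End Graphs.

(* Raw data (V_1, ..., V_n, C) of a geometry of rank n whose elements live in a
   common carrier T; types are indexed from 0, so V_(i+1) is [elt G i].  The
   requirements on the data are in [is_geometry], which has to be established
   for shadows and residues. *)
Record pregeometry (T : Type) (n : nat) := Pregeometry {
  elt : 'I_n -> set T;
  chamber : set ('I_n -> T) }.

Section Geometries.
Variables (T : Type) (n : nat) (G : pregeometry T n).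

Definition is_geometry : Prop :=
  [/\ forall i, elt G i !=set0,
      forall i j, i != j -> elt G i `&` elt G j = set0
    & forall c, chamber G c -> forall i, elt G i (c i)].

Definition elements : set T := [set v | exists i, elt G i v].

Definition incident (v w : T) : Prop :=
  exists i j, [/\ i != j, elt G i v, elt G j w
                & exists c, [/\ chamber G c, c i = v & c j = w]].

Definition connected_geometry : Prop := connected_graph elements incident.

Definition dual : pregeometry T n :=
  Pregeometry (fun i => elt G (rev_ord i))
              [set c | chamber G (fun i => c (rev_ord i))].

Definition below (i : 'I_n) (j : 'I_i) : 'I_n :=
  widen_ord (ltnW (ltn_ord i)) j.

Lemma above_proof (i : 'I_n) (j : 'I_(n - i.+1)) : i.+1 + j < n.
Proof. by rewrite -ltn_subRL. Qed.

Definition above (i : 'I_n) (j : 'I_(n - i.+1)) : 'I_n :=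
  Ordinal (above_proof j).

Definition shadow (i : 'I_n) (v : T) : pregeometry T i :=
  Pregeometry
    (fun j => [set w | elt G (below j) w /\ incident w v])
    [set c | exists d, [/\ chamber G d, d i = v
                         & c = fun j : 'I_i => d (below j)]].

Definition residue (i : 'I_n) (v : T) : pregeometry T (n - i.+1) :=
  Pregeometry
    (fun j => [set w | elt G (above j) w /\ incident v w])
    [set c | exists d, [/\ chamber G d, d i = v
                         & c = fun j : 'I_(n - i.+1) => d (above j)]].

End Geometries.

Section PointsAndLines.
Variables (T : Type) (n : nat) (G : pregeometry T n.+2).

Definition points : set T := elt G ord0.
Definition lines : set T := elt G (@Ordinal n.+2 1 isT).

(* The set of points of an element; for a point p it is [set p]. *)
Definition pts (v : T) : set T :=
  [set p | points p /\ (p = v \/ incident G p v)].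

Definition collinear (x y : T) : Prop :=
  [/\ points x, points y, x <> y
    & exists2 L, lines L & incident G x L /\ incident G y L].

(* The elements are identified with their sets of points, incidence being
   symmetrised containment: an element is determined by its type and its set of
   points, and the chambers are the maximal flags for inclusion. *)
Definition elements_are_point_sets : Prop :=
  (forall i v w, elt G i v -> elt G i w -> pts v = pts w -> v = w) /\
  (forall c, chamber G c <->
     (forall i, elt G i (c i)) /\
     (forall i j : 'I_n.+2, (i <= j)%N -> pts (c i) `<=` pts (c j))).

Definition subspace (X : set T) : Prop :=
  X `<=` points /\
  forall L x y, lines L -> x <> y -> X x -> X y -> pts L x -> pts L y ->
    pts L `<=` X.

Definition singular (X : set T) : Prop :=
  subspace X /\ forall x y, X x -> X y -> x <> y -> collinear x y.

Definition maximal_singular (X : set T) : Prop :=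
  singular X /\ forall Y, singular Y -> X `<=` Y -> Y = X.

(* F 0 < ... < F k is a chain of non-empty singular subspaces inside X. *)
Definition singular_chain (X : set T) (k : nat) : Prop :=
  exists F : nat -> set T,
    (forall i, (i <= k)%N -> [/\ singular (F i), F i !=set0 & F i `<=` X]) /\
    (forall i, (i < k)%N -> F i `<` F i.+1).

(* Points have projective dimension 0. *)
Definition proj_dim (X : set T) (k : nat) : Prop :=
  singular_chain X k /\ ~ singular_chain X k.+1.

End PointsAndLines.

Definition planes (T : Type) (n : nat) (G : pregeometry T n.+3) : set T :=
  elt G (@Ordinal n.+3 2 isT).

Definition symps (T : Type) (n : nat) (G : pregeometry T n.+4) : set T :=
  elt G (@Ordinal n.+4 3 isT).

Definition generalised_octagon (T : Type) (G : pregeometry T 2) : Prop :=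
  [/\ is_geometry G,
      graph_diameter (elements G) (incident G) 8,
      graph_girth (elements G) (incident G) 16
    & exists s t : Type, (* cardinals s, t >= 2 *)
        [/\ `I_2 #<= [set: s],
            `I_2 #<= [set: t],
            forall x, points G x ->
              [set L | lines G L /\ incident G x L] #= [set: option t]
          & forall L, lines G L ->
              [set x | points G x /\ incident G x L] #= [set: option s]]].

Definition polar_space3 (T : Type) (G : pregeometry T 3) : Prop :=
  [/\ is_geometry G,
      elements_are_point_sets G,
      (* lines and planes are the singular subspaces of dimension 1 and 2, and
         the planes are the maximal singular subspaces *)
      forall X : set T,
        [/\ (exists2 L, lines G L & X = pts G L) <->
              singular G X /\ proj_dim G X 1,
            (exists2 P, planes G P & X = pts G P) <->
              singular G X /\ proj_dim G X 2
          & (exists2 P, planes G P & X = pts G P) <-> maximal_singular G X]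
    & [/\ forall L, lines G L -> `I_3 #<= pts G L,
          forall x, points G x ->
            exists y, [/\ points G y, y <> x & ~ collinear G x y]
        & forall x L, points G x -> lines G L -> ~ incident G x L ->
            (exists! y, pts G L y /\ collinear G x y) \/
            (forall y, pts G L y -> collinear G x y)]].

Definition dual_polar_space3 (T : Type) (G : pregeometry T 3) : Prop :=
  polar_space3 (dual G).

Section Metasymplectic.
Variables (T : Type) (M : pregeometry T 4).

Definition MS1 : Prop :=
  forall S, symps M S -> polar_space3 (shadow M (@Ordinal 4 3 isT) S).

Definition MS2 : Prop :=
  forall x, points M x -> dual_polar_space3 (residue M (@Ordinal 4 0 isT) x).

Definition MS3 : Prop :=
  forall S S', symps M S -> symps M S' -> S <> S' ->
    let I := pts M S `&` pts M S' in
    [\/ I = set0,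
        exists2 x, points M x & I = [set x],
        exists2 L, lines M L & I = pts M L
      | exists2 P, planes M P & I = pts M P].

Definition metasymplectic_space : Prop :=
  [/\ is_geometry M /\ elements_are_point_sets M,
      connected_geometry M,
      exists S S', [/\ symps M S, symps M S' & S <> S']
    & [/\ MS1, MS2 & MS3]].

Definition symplectic (x y : T) : Prop :=
  [/\ points M x, points M y, x <> y, ~ collinear M x y
    & exists! S, [/\ symps M S, incident M x S & incident M y S]].

Definition special (x y : T) : Prop :=
  [/\ points M x, points M y, x <> y, ~ collinear M x y
    & exists! z, collinear M x z /\ collinear M y z].

Definition opposite (x y : T) : Prop :=
  [/\ points M x, points M y, x <> y
    & ~ exists z, collinear M x z /\ collinear M y z].

End Metasymplectic.

Section Embeddings.
Variables (T : Type) (O : pregeometry T 2) (M : pregeometry T 4).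

Definition fully_embedded : Prop :=
  [/\ points O `<=` points M,
      lines O `<=` lines M,
      forall x L, points O x -> lines O L -> (incident O x L <-> incident M x L)
    & forall x L, lines O L -> points M x -> incident M x L -> points O x].

Definition octagon_distance (k : nat) (x y : T) : Prop :=
  at_distance (collinear O) k x y.

Definition pseudo_isometric : Prop :=
  fully_embedded /\
  forall x y, points O x -> points O y -> x <> y ->
    [/\ octagon_distance 1 x y <-> collinear M x y,
        octagon_distance 2 x y <-> symplectic M x y,
        octagon_distance 3 x y <-> special M x y
      & octagon_distance 4 x y <-> opposite M x y].

End Embeddings.

(* Main.v *)
Require Import Defs.
From mathcomp Require Import all_boot.
From mathcomp Require Import boolp classical_sets functions cardinality.
From mathcomp Require Import zify.

(** Only the implication from (S) to pseudo-isometry needs an argument, and there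
    the distances 1 and 2 are clear. So pairs at distance 3 have to be shown to be
    special, and pairs at distance 4 to be opposite.

    On the side of the metasymplectic space, everything is derived from the polar
    spaces that are the symps, and from those that are the duals of the point
    residues. Say that two points are cosymp if some symp contains both. The main
    facts are: a common neighbour of two noncollinear points of a symp is in that
    symp (common_in_symp); two points with two common neighbours are cosymp
    (quadrangle_cosymp), so that a pair which is not cosymp but has a common
    neighbour is special, and has a centre; and if z, x, y, t is a path such that
    neither (z, y) nor (x, t) is cosymp, then z and t are opposite (not_close).
    Each is obtained by moving a line of the configuration inside a symp, until
    two further points become cosymp. As a consequence, if x is special to a
    point y of a line L, then either no other point of L or every point of L has
    a neighbour in common with x (close_along_line).

    On the side of the octagon, non-backtracking incidence walks with the same ends
    and total length less than 16 coincide, and every such walk of length 9 extends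
    to an apartment, that is, an ordinary octagon with points b_0, ..., b_7.

    By (S), points at distance 3 have a common neighbour and are collinear if they
    are cosymp. If b_1 and b_4 are collinear, then neither (b_0, b_4) nor
    (b_1, b_5) is cosymp, and not_close makes b_0 and b_5 opposite, though they are
    at distance 3 (ap_dist3_noncollinear). So points at distance 3 are special,
    and points at distance 4 are not cosymp.

    Suppose that b_0 and b_4 are not opposite. By close_along_line, applied to lines
    of the octagon, this property spreads to (b_1, b_5), and around the apartment
    (ap_close_step). Let p_i be the centre of (b_i, b_(i+3)) and w_i that of
    (b_i, b_(i+4)). Then b_(i+2) is on the line joining the distinct points p_i and
    p_(i+1), and w_i is perpendicular to that line (path4_centres). It follows that
    w_0 = w_2, hence that w_0 is perpendicular to p_1 and p_2, thus to b_3. This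
    identifies w_0 with both p_0 and p_1, a contradiction (ap_not_close). *)

Set Implicit Arguments.
Unset Strict Implicit.
Unset Printing Implicit Defensive.

Local Open Scope classical_set_scope.
Local Open Scope card_scope.

(** * Incidence in a geometry *)

Lemma card_ge_inj (U : Type) (A : set U) n :
  `I_n #<= A -> exists2 f : 'I_n -> U, injective f & forall i, A (f i).
Proof.
move=> /card_leP/injfunPex[g _ gI].
have mem (i : 'I_n) : (i : nat) \in `I_n by apply/mem_set/ltn_ord.
exists (fun i => val (g (SigSub (mem i)))) => [i j eij|i]; last first.
  by apply: set_mem; case: (g _).
by apply: ord_inj; move/val_inj/gI: eij; rewrite !inE => /(_ Logic.I Logic.I) [] .
Qed.

Lemma card3_avoid2 (U : Type) (A : set U) (a b : U) :
  `I_3 #<= A -> exists x, [/\ A x, x <> a & x <> b].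
Proof.
move=> /card_ge_inj[f fI fA]; apply: contrapT => none.
have ab i : f i = a \/ f i = b.
  case: (pselect (f i = a)) => [|na]; first by left.
  by case: (pselect (f i = b)) => [|nb]; [right|case: none; exists (f i)].
have clash i j : i != j -> f i <> f j by move=> /eqP ij /fI.
have := clash ord0 (@Ordinal 3 1 isT) isT.
have := clash ord0 (@Ordinal 3 2 isT) isT.
have := clash (@Ordinal 3 1 isT) (@Ordinal 3 2 isT) isT.
by have [->|->] := ab ord0; have [->|->] := ab (@Ordinal 3 1 isT);
  have [->|->] := ab (@Ordinal 3 2 isT).
Qed.

Section Incidence.
Variables (T : Type) (n : nat) (G : pregeometry T n).
Hypothesis geoG : is_geometry G.

Lemma type_inj i j v : elt G i v -> elt G j v -> i = j.
Proof.
case: geoG => _ disj _ iv jv; apply: contrapT => /eqP ij.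
by have /seteqP[/(_ v)/= h _] := disj _ _ ij; apply: h.
Qed.

Lemma incidentC v w : incident G v w -> incident G w v.
Proof.
move=> [i [j [ij iv jw [c [Cc cv cw]]]]]; exists j, i; split => //.
  by rewrite eq_sym.
by exists c.
Qed.

Lemma incident_chamber i j v w : i != j -> elt G i v -> elt G j w ->
  incident G v w <-> exists c, [/\ chamber G c, c i = v & c j = w].
Proof.
move=> ij iv jw; split=> [[i' [j' [_ iv' jw' Hc]]]|Hc]; last by exists i, j.
by rewrite (type_inj iv iv') (type_inj jw jw').
Qed.

Lemma incident_type_neq i v w : elt G i v -> elt G i w -> ~ incident G v w.
Proof.
move=> iv iw [k [l [kl kv lw _]]]; move/eqP: kl; apply.
by rewrite -(type_inj iv kv) -(type_inj iw lw).
Qed.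

End Incidence.

Section PointSets.
Variables (T : Type) (n : nat) (G : pregeometry T n.+2).
Hypothesis geoG : is_geometry G.

Definition perp (x y : T) : Prop := x = y \/ collinear G x y.

Lemma collinearC x y : collinear G x y -> collinear G y x.
Proof.
by move=> [px py xy [L lL [xL yL]]]; split => //; [move=> e; apply: xy|exists L].
Qed.

Lemma perpC x y : perp x y -> perp y x.
Proof. by case=> [->|/collinearC]; [left|right]. Qed.

Lemma perp_neq x y : x <> y -> perp x y -> collinear G x y.
Proof. by move=> xy []. Qed.

Lemma pts_point x : points G x -> pts G x = [set x].
Proof.
move=> px; apply/seteqP; split => y /=; last by move=> ->; split; [|left].
by case=> py [//|/(incident_type_neq geoG py px)].
Qed.

Lemma ptsP i v x : i != ord0 -> elt G i v ->
  pts G v x <-> points G x /\ incident G x v.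
Proof.
move=> i0 iv; split=> [[px [xv|]//]|[px xv]]; last by split => //; right.
move: iv; rewrite -xv => iv; case/eqP: i0; exact: (type_inj geoG iv px).
Qed.

End PointSets.

Arguments perp {T n} G x y.

(** * Polar spaces of rank 3 *)

Section Polar.
Variables (T : Type) (G : pregeometry T 3).
Hypothesis polG : polar_space3 G.

Let geoG : is_geometry G. Proof. by case: polG. Qed.
Let setsG : elements_are_point_sets G. Proof. by case: polG. Qed.

Local Notation pt := (points G).
Local Notation ln := (lines G).
Local Notation pl := (planes G).
Local Notation "x _|_ y" := (perp G x y) (at level 70).

Lemma pts_sub_points v x : pts G v x -> pt x. Proof. by case. Qed.

Lemma line_singular L : ln L -> singular G (pts G L).
Proof.
move=> lL; case: polG => _ _ /(_ (pts G L))[h _ _] _.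
by case: h.1 => //; exists L.
Qed.

Lemma line_dim L : ln L -> proj_dim G (pts G L) 1.
Proof.
move=> lL; case: polG => _ _ /(_ (pts G L))[h _ _] _.
by case: h.1 => //; exists L.
Qed.

Lemma plane_singular P : pl P -> singular G (pts G P).
Proof.
move=> pP; case: polG => _ _ /(_ (pts G P))[_ h _] _.
by case: h.1 => //; exists P.
Qed.

Lemma plane_dim P : pl P -> proj_dim G (pts G P) 2.
Proof.
move=> pP; case: polG => _ _ /(_ (pts G P))[_ h _] _.
by case: h.1 => //; exists P.
Qed.

Lemma plane_maximal P : pl P -> maximal_singular G (pts G P).
Proof.
move=> pP; case: polG => _ _ /(_ (pts G P))[_ _ h] _.
by apply: h.1; exists P.
Qed.

Lemma maximal_plane X : maximal_singular G X -> exists2 P, pl P & X = pts G P.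
Proof. by move=> mX; case: polG => _ _ /(_ X)[_ _ h] _; apply: h.2. Qed.

Lemma line_neq_plane L P : ln L -> pl P -> pts G L <> pts G P.
Proof.
by move=> /line_dim[_ nd] /plane_dim[d _] e; apply: nd; rewrite e.
Qed.

Lemma plane_inj P P' : pl P -> pl P' -> pts G P = pts G P' -> P = P'.
Proof. exact: setsG.1. Qed.

Lemma line_avoid2 L a b : ln L -> exists x, [/\ pts G L x, x <> a & x <> b].
Proof. by move=> lL; apply: card3_avoid2; case: polG => _ _ _ [h _ _]; apply: h. Qed.

Lemma pts_line L x : ln L -> pts G L x <-> pt x /\ incident G x L.
Proof. exact: ptsP. Qed.

Lemma collinear_lineP x y : collinear G x y ->
  exists L, [/\ ln L, pts G L x & pts G L y].
Proof. by move=> [px py _ [L lL [xL yL]]]; exists L; split=> //; apply/pts_line. Qed.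

Lemma singular_perp X x y : singular G X -> X x -> X y -> x _|_ y.
Proof.
move=> [_ sX] Xx Xy; case: (pselect (x = y)) => [->|xy]; first by left.
by right; apply: sX.
Qed.

Lemma singular_line X L x y : singular G X -> ln L -> X x -> X y -> x <> y ->
  pts G L x -> pts G L y -> pts G L `<=` X.
Proof. by move=> [[_ sX] _] lL Xx Xy xy Lx Ly; apply: (sX L x y). Qed.

Lemma line_uniq L L' x y : ln L -> ln L' -> x <> y ->
  pts G L x -> pts G L y -> pts G L' x -> pts G L' y -> L = L'.
Proof.
move=> lL lL' xy Lx Ly L'x L'y; apply: (setsG.1 _ _ _ lL lL'); apply/seteqP; split.
  exact: (singular_line (line_singular lL') lL L'x L'y xy Lx Ly).
exact: (singular_line (line_singular lL) lL' Lx Ly xy L'x L'y).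
Qed.

Lemma one_or_all x L : pt x -> ln L ->
  (exists y, pts G L y /\ x _|_ y) /\
  (forall y y', pts G L y -> pts G L y' -> y <> y' -> x _|_ y -> x _|_ y' ->
     forall z, pts G L z -> x _|_ z).
Proof.
move=> px lL; have [xL|xL] := pselect (pts G L x).
  split; first by exists x; split => //; left.
  by move=> _ _ _ _ _ _ _ z Lz; apply: singular_perp (line_singular lL) xL Lz.
have nxL : ~ incident G x L by move=> i; apply: xL; apply/pts_line.
have neq y : pts G L y -> x <> y by move=> Ly e; apply: xL; rewrite e.
case: polG => _ _ _ [_ _ /(_ x L px lL nxL)] [[y [[Ly xy] uy]]|all].
  split; first by exists y; split => //; right.
  move=> z z' Lz Lz' zz' [/(neq _ Lz)//|xz] [/(neq _ Lz')//|xz'].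
  by case: zz'; rewrite -(uy z) // -(uy z').
split; last by move=> _ _ _ _ _ _ _ z Lz; right; apply: all.
have [y [Ly _ _]] := line_avoid2 x x lL.
by exists y; split => //; right; apply: all.
Qed.

Lemma perp_line x L y y' : pt x -> ln L -> pts G L y -> pts G L y' -> y <> y' ->
  x _|_ y -> x _|_ y' -> forall z, pts G L z -> x _|_ z.
Proof. by move=> px lL; apply: (one_or_all px lL).2. Qed.

Definition clique (X : set T) : Prop :=
  X `<=` pt /\ forall x y, X x -> X y -> x _|_ y.

(** A maximal clique is closed under lines by the one-or-all axiom, hence it is
    a maximal singular subspace, that is, a plane. *)
Lemma clique_plane X : clique X -> exists2 P, pl P & X `<=` pts G P.
Proof.
move=> cX.
(* Maximality is stated for X together with C, so that the empty chain causes no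
   trouble: its union is empty. *)
have [C [cC maxC]] : exists C, clique (X `|` C) /\
    forall D, C `<` D -> ~ clique (X `|` D).
  apply: (@Zorn_bigcup _ (fun C => clique (X `|` C))) => F FC totF; split.
    by move=> x [/cX.1//|[C FCC Cx]]; apply: (FC _ FCC).1; right.
  move=> x y [Xx|[C FCC Cx]] [Xy|[D FD Dy]].
  - exact: cX.2.
  - by apply: (FC _ FD).2; [left|right].
  - by apply: (FC _ FCC).2; [right|left].
  case: (totF _ _ FCC FD) => h.
    by apply: (FC _ FD).2; right => //; apply: h.
  by apply: (FC _ FCC).2; right => //; apply: h.
have addC z : pt z -> (forall x, (X `|` C) x -> z _|_ x) -> (X `|` C) z.
  move=> pz zC; apply: contrapT => nz; apply: (maxC (z |` C)).
    split; first by move=> x Cx; right.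
    by move=> /(_ z) h; apply: nz; right; apply: h; left.
  have sub x : (X `|` (z |` C)) x -> x = z \/ (X `|` C) x.
    by move=> [Xx|[->|Cx]]; [right; left|left|right; right].
  split=> [x /sub[->//|/cC.1//]|x y /sub[->|Cx] /sub[->|Cy]].
  - by left.
  - exact: zC.
  - by apply: perpC; apply: zC.
  - exact: cC.2.
have sC : singular G (X `|` C).
  split; last by move=> x y Cx Cy xy; apply: perp_neq => //; apply: cC.2.
  split=> [|L x y lL xy Cx Cy Lx Ly z Lz]; first exact: cC.1.
  apply: addC => [|u Cu]; first exact: pts_sub_points Lz.
  apply/perpC/(perp_line _ lL Lx Ly xy) => //; first exact: cC.1.
    exact: cC.2.
  exact: cC.2.
have [|P pP eP] := @maximal_plane (X `|` C).
  split=> // Y sY CY; apply/seteqP; split=> // z Yz.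
  apply: addC => [|x Cx]; first exact: sY.1.1.
  by apply: (singular_perp sY) => //; apply: CY.
by exists P => // x Xx; rewrite -eP; left.
Qed.

Lemma perp_collect x y P : pl P -> pts G P x -> pts G P y -> x _|_ y.
Proof. by move=> /plane_singular; apply: singular_perp. Qed.

Lemma plane_perp_mem P z : pl P -> pt z -> (forall x, pts G P x -> z _|_ x) ->
  pts G P z.
Proof.
move=> pP pz zP.
have [|P' pP' sub] := @clique_plane (z |` pts G P).
  split=> [x [->//|]|x y [->|Px] [->|Py]]; first exact: pts_sub_points.
  - by left.
  - exact: zP.
  - by apply/perpC/zP.
  - exact: perp_collect pP Px Py.
have [_ /(_ (pts G P') (plane_singular pP')) <-] := plane_maximal pP.
  by apply: sub; left.
by move=> x Px; apply: sub; right.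
Qed.

Lemma point_singular x : pt x -> singular G [set x].
Proof.
move=> px; split; last by move=> y z -> ->.
by split=> [y -> //|L y z _ yz ey ez]; case: yz; rewrite ey ez.
Qed.

(** A line is a hyperplane of every plane through it: a singular subspace
    strictly in between would give a chain of length 3 in the plane. *)
Lemma line_hyperplane P L X u : pl P -> ln L -> singular G X ->
  pts G L `<=` X -> X `<=` pts G P -> X u -> ~ pts G L u -> X = pts G P.
Proof.
move=> pP lL sX LX XP Xu nLu; apply/seteqP; split=> // z Pz.
apply: contrapT => nXz; have [_] := plane_dim pP; apply.
have [x [Lx _ _]] := line_avoid2 u u lL.
have [y [Ly yx _]] := line_avoid2 x x lL.
exists (fun i => nth (pts G P) [:: [set x]; pts G L; X] i); split.
  case=> [|[|[|i]]] /= i3.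
  - split; first exact: point_singular (pts_sub_points Lx).
      by exists x.
    by move=> _ ->; apply/XP/LX.
  - split; [exact: line_singular|by exists x|].
    by move=> v Lv; apply/XP/LX.
  - by split => //; exists u.
  - rewrite nth_default //; split=> //; first exact: plane_singular.
    by exists z.
case=> [|[|[|]]] //= _; split=> //.
- by move=> _ ->.
- by move=> /(_ y Ly).
- by move=> /(_ u Xu).
- by move=> /(_ z Pz).
Qed.

Lemma plane_triangle P : pl P -> exists a b c, [/\ pts G P a, pts G P b,
  pts G P c & a <> b /\ forall L, ln L -> pts G L a -> pts G L b -> ~ pts G L c].
Proof.
move=> /plane_dim[[F [FP Fs]] _].
have [sF0 [a F0a] _] := FP 0 isT.
have [F01 /nonsubset[b [F1b nF0b]]] := Fs 0 isT.
have [F12 /nonsubset[c [F2c nF1c]]] := Fs 1 isT.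
have [sF1 _ F1P] := FP 1 isT; have [_ _ F2P] := FP 2 isT.
have ab : a <> b by move=> e; apply: nF0b; rewrite -e.
exists a, b, c; split; [exact/F1P/F01|exact: F1P|exact: F2P|split=> //].
move=> L lL La Lb Lc; apply: nF1c.
exact: (singular_line sF1 lL (F01 _ F0a) F1b ab La Lb).
Qed.

Lemma plane_line P x y : pl P -> pts G P x -> pts G P y -> x <> y ->
  exists L, [/\ ln L, pts G L x, pts G L y & pts G L `<=` pts G P].
Proof.
move=> pP Px Py xy.
have [L [lL Lx Ly]] := collinear_lineP (perp_neq xy (perp_collect pP Px Py)).
by exists L; split => //; apply: (singular_line (plane_singular pP) lL Px Py xy).
Qed.

Lemma plane_line_avoid P u : pl P ->
  exists L, [/\ ln L, pts G L `<=` pts G P & ~ pts G L u].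
Proof.
move=> pP; have [a [b [c [Pa Pb Pc [ab nc]]]]] := plane_triangle pP.
have [ac bc] : a <> c /\ b <> c.
  have [L [lL La Lb _]] := plane_line pP Pa Pb ab.
  by split=> e; apply: (nc L lL La Lb); rewrite -e.
have [L [lL La Lb LP]] := plane_line pP Pa Pb ab.
have [M [lM Ma Mc MP]] := plane_line pP Pa Pc ac.
have [N [lN Nb Nc NP]] := plane_line pP Pb Pc bc.
have [Lu|] := pselect (pts G L u); last by exists L.
have [Mu|] := pselect (pts G M u); last by exists M.
exists N; split=> // Nu; have [au|au] := pselect (a = u).
  by apply: (nc N lN) => //; rewrite au.
by apply: (nc L lL La Lb); rewrite (line_uniq lL lM au La Lu Ma Mu).
Qed.

Lemma plane_off_line P L : pl P -> ln L -> pts G L `<=` pts G P ->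
  exists2 x, pts G P x & ~ pts G L x.
Proof.
move=> pP lL LP; apply: contrapT => none; apply: (line_neq_plane lL pP).
apply/seteqP; split=> // x Px; apply: contrapT => nLx.
by apply: none; exists x.
Qed.

Lemma clique_cons_line x L : pt x -> ln L ->
  (forall y, pts G L y -> x _|_ y) ->
  exists P, [/\ pl P, pts G P x & pts G L `<=` pts G P].
Proof.
move=> px lL xL; have [|P pP sub] := @clique_plane (x |` pts G L).
  split=> [y [->//|]|y z [->|Ly] [->|Lz]]; first exact: pts_sub_points.
  - by left.
  - exact: xL.
  - by apply/perpC/xL.
  - exact: singular_perp (line_singular lL) Ly Lz.
by exists P; split=> //; [apply: sub; left|move=> y Ly; apply: sub; right].
Qed.

(** One-or-all yields a perpendicular point u on some line of P, and then another
    one on a line of P that misses u. *)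
Lemma plane_project x P : pt x -> pl P -> exists L Q,
  [/\ ln L, pts G L `<=` pts G P, pl Q, pts G Q x & pts G L `<=` pts G Q].
Proof.
move=> px pP; have [M [lM MP _]] := plane_line_avoid x pP.
have [[u [Mu xu]] _] := one_or_all px lM.
have [N [lN NP nNu]] := plane_line_avoid u pP.
have [[v [Nv xv]] _] := one_or_all px lN.
have uv : u <> v by move=> e; apply: nNu; rewrite e.
have [L [lL Lu Lv LP]] := plane_line pP (MP _ Mu) (NP _ Nv) uv.
have [Q [pQ Qx LQ]] := clique_cons_line px lL (perp_line px lL Lu Lv uv xu xv).
by exists L, Q; split.
Qed.

(** A point u of L sees a line of P, and another point of L sees a point of that
    line; this point is perpendicular to all of L. *)
Lemma line_gate L P : ln L -> pl P ->
  exists x Q, [/\ pts G P x, pl Q, pts G Q x & pts G L `<=` pts G Q].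
Proof.
move=> lL pP; have [u [Lu _ _]] := line_avoid2 L L lL.
have [v [Lv vu _]] := line_avoid2 u u lL.
have pu := pts_sub_points Lu; have pv := pts_sub_points Lv.
have [M [Q [lM MP pQ Qu MQ]]] := plane_project pu pP.
have [[x [Mx vx]] _] := one_or_all pv lM.
have px := pts_sub_points Mx.
have [|||R [pR Rx LR]] := @clique_cons_line x L => //.
  apply: (perp_line px lL Lu Lv) => [e||]; first by case: vu.
    by apply: (perp_collect pQ) => //; apply: MQ.
  exact: perpC.
by exists x, R; split=> //; apply: MP.
Qed.

Lemma perp_trace P x : pt x -> pl P -> singular G (pts G P `&` [set y | x _|_ y]).
Proof.
move=> px pP; split; last first.
  move=> y z [Py _] [Pz _] yz; exact: perp_neq yz (perp_collect pP Py Pz).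
split=> [y [/pts_sub_points//]|L y z lL yz [Py xy] [Pz xz] Ly Lz t Lt]; split.
  exact: (singular_line (plane_singular pP) lL Py Pz yz Ly Lz).
exact: (perp_line px lL Ly Lz yz xy xz).
Qed.

(** As a plane is a maximal clique, x does not see all of P, and a proper subspace
    of P containing a line is that line. *)
Lemma perp_traceE P L x : pt x -> pl P -> ~ pts G P x -> ln L ->
  pts G L `<=` pts G P -> (forall y, pts G L y -> x _|_ y) ->
  forall y, pts G P y -> x _|_ y -> pts G L y.
Proof.
move=> px pP nPx lL LP xL y Py xy; apply: contrapT => nLy; apply: nPx.
apply: plane_perp_mem => // z Pz.
suff e : pts G P `&` [set y | x _|_ y] = pts G P.
  by move: Pz; rewrite -{1}e => -[].
apply: (line_hyperplane pP lL (perp_trace px pP) _ _ (u := y)) => //.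
by move=> t Lt; split; [apply: LP|apply: xL].
Qed.

(** If a line of the plane P is all that some point off P sees of P, then it
    meets every line of P, as one-or-all forces that point to see a point of
    the latter. *)
Lemma lines_meet P Q L M : pl P -> pl Q -> P <> Q -> ln L -> ln M ->
  pts G L `<=` pts G P -> pts G L `<=` pts G Q -> pts G M `<=` pts G P ->
  exists x, pts G L x /\ pts G M x.
Proof.
move=> pP pQ PQ lL lM LP LQ MP.
have [x Qx nPx] : exists2 x, pts G Q x & ~ pts G P x.
  apply: contrapT => none; apply: PQ; apply: plane_inj => //.
  have [_ h] := plane_maximal pQ; apply: h; first exact: plane_singular.
  by move=> x Qx; apply: contrapT => nPx; apply: none; exists x.
have px := pts_sub_points Qx.
have [[y [My xy]] _] := one_or_all px lM.
exists y; split=> //; apply: (perp_traceE px pP nPx lL LP) => //; last exact: MP.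
by move=> z Lz; apply: (perp_collect pQ) => //; apply: LQ.
Qed.

(** The two lines meet inside Q. *)
Lemma planes_meet P Q R L M : pl P -> pl Q -> pl R -> ln L -> ln M ->
  pts G L `<=` pts G P -> pts G L `<=` pts G Q ->
  pts G M `<=` pts G Q -> pts G M `<=` pts G R ->
  exists x, pts G P x /\ pts G R x.
Proof.
move=> pP pQ pR lL lM LP LQ MQ MR; have [QP|QP] := pselect (Q = P).
  have [x [Mx _ _]] := line_avoid2 M M lM.
  by exists x; rewrite -QP; split; [apply: MQ|apply: MR].
have [x [Lx Mx]] := lines_meet pQ pP QP lL lM LQ LP MQ.
by exists x; split; [apply: LP|apply: MR].
Qed.

(** Here the rank enters: there is no singular subspace of projective dimension 3,
    so a point perpendicular to the triangle p, q, r is in the plane spanned by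
    it. *)
Lemma perp_triangle p q r a c L : pt a -> pt c -> ln L -> p <> q ->
  pts G L p -> pts G L q -> pt r -> ~ pts G L r -> p _|_ r -> q _|_ r ->
  a _|_ p -> a _|_ q -> a _|_ r -> c _|_ p -> c _|_ q -> c _|_ r -> a _|_ c.
Proof.
move=> pa pc lL pq Lp Lq pr nLr rp rq ap aq ar cp cq cr.
have [|||P [pP Pr LP]] := @clique_cons_line r L => //.
  by apply: (perp_line pr lL Lp Lq pq); apply: perpC.
have mem x : pt x -> x _|_ p -> x _|_ q -> x _|_ r -> pts G P x.
  move=> px xp xq xr; apply: contrapT => nPx; apply: nLr.
  apply: (perp_traceE px pP nPx lL LP) => //.
  exact: (perp_line px lL Lp Lq pq).
by apply: (perp_collect pP); apply: mem.
Qed.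

Lemma polar_line_plane_incident L P : ln L -> pl P ->
  pts G L `<=` pts G P -> incident G L P.
Proof.
move=> lL pP LP; have [x [Lx _ _]] := line_avoid2 L L lL.
have px := pts_sub_points Lx.
exists (@Ordinal 3 1 isT), (@Ordinal 3 2 isT); split=> //.
exists (fun i : 'I_3 => nth x [:: x; L; P] i); split=> //; apply/setsG.2.
have xL : pts G x `<=` pts G L by rewrite (pts_point geoG px) => _ ->.
have xP := subset_trans xL LP.
have ord3P (i : 'I_3) :
    [\/ i = ord0, i = @Ordinal 3 1 isT | i = @Ordinal 3 2 isT].
  by case: i => -[|[|[|//]]] h;
    [apply: Or31|apply: Or32|apply: Or33]; apply: val_inj.
split=> [i|i j]; case: (ord3P i) => ->; rewrite //=;
  case: (ord3P j) => -> //= _;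
  first [exact: xL|exact: xP|exact: LP|exact: subset_refl].
Qed.

(** For a plane P on x, the line of P seen by y consists of common neighbours. *)
Lemma noncollinear_common x y a : pt x -> pt y -> ~ x _|_ y ->
  exists z, [/\ z <> a, collinear G x z & collinear G y z].
Proof.
move=> px py nxy.
have [|P pP Px] := @clique_plane [set x].
  by split=> [_ ->//|_ _ -> ->]; left.
have {}Px : pts G P x by apply: Px.
have nPy : ~ pts G P y by move=> Py; apply: nxy; apply: (perp_collect pP).
have [L [Q [lL LP pQ Qy LQ]]] := plane_project py pP.
have [z [Lz za _]] := line_avoid2 a a lL.
exists z; split=> //; apply: perp_neq.
- by move=> e; apply: nxy; rewrite e; apply: (perp_collect pQ) => //; apply: LQ.
- by apply: (perp_collect pP) => //; apply: LP.
- by move=> e; apply: nPy; rewrite e; apply: LP.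
- by apply: (perp_collect pQ) => //; apply: LQ.
Qed.

End Polar.

(** * Shadows and residues of a metasymplectic space *)

Section Metasymplectic.
Variables (T : Type) (M : pregeometry T 4).
Hypothesis metaM : metasymplectic_space M.

Let geoM : is_geometry M. Proof. by case: metaM => -[]. Qed.
Let setsM : elements_are_point_sets M. Proof. by case: metaM => -[]. Qed.

Local Notation pt := (points M).
Local Notation ln := (lines M).
Local Notation pl := (planes M).
Local Notation sy := (symps M).
Local Notation o0 := (@Ordinal 4 0 isT).
Local Notation o1 := (@Ordinal 4 1 isT).
Local Notation o2 := (@Ordinal 4 2 isT).
Local Notation o3 := (@Ordinal 4 3 isT).
Local Notation "x \on v" := (pts M v x) (at level 70).
Local Notation "v \in' w" := (incident M v w) (at level 70).

Lemma points_o0 : pt = elt M o0.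
Proof. by congr (elt M _); apply: val_inj. Qed.

Lemma ord4P (i : 'I_4) : [\/ i = o0, i = o1, i = o2 | i = o3].
Proof.
by case: i => -[|[|[|[|//]]]] h;
  [apply: Or41|apply: Or42|apply: Or43|apply: Or44]; apply: val_inj.
Qed.

Lemma pts_pt v x : x \on v -> pt x. Proof. by case. Qed.

Lemma chamber_sub c (i j : 'I_4) : chamber M c -> i <= j ->
  pts M (c i) `<=` pts M (c j).
Proof. by move=> /setsM.2[_ h]; apply: h. Qed.

Lemma chamber_elt c i : chamber M c -> elt M i (c i).
Proof. by move=> /setsM.2[h _]; apply: h. Qed.

Definition flag (x L P S : T) (i : 'I_4) : T := nth x [:: x; L; P; S] i.

Lemma flag_chamber x L P S : ln L -> pl P -> sy S -> x \on L ->
  pts M L `<=` pts M P -> pts M P `<=` pts M S -> chamber M (flag x L P S).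
Proof.
move=> lL pP sS xL LP PS; apply/setsM.2; split.
  by move=> i; case: (ord4P i) => -> //; rewrite -points_o0; apply: pts_pt xL.
have sx : pts M x `<=` pts M L.
  by rewrite (pts_point geoM (pts_pt xL)) => _ ->.
have xP := subset_trans sx LP; have xS := subset_trans xP PS.
have LS := subset_trans LP PS.
by move=> i j; case: (ord4P i) => ->; case: (ord4P j) => -> //= _.
Qed.

(** An element in no chamber would be isolated in the incidence graph. *)
Lemma elt_in_chamber i v : elt M i v -> exists2 c, chamber M c & c i = v.
Proof.
move=> iv; have [j ij] : exists j : 'I_4, i != j.
  by case: (ord4P i) => ->; [exists o1|exists o0|exists o0|exists o0].
have [ne _ _] := geoM; have [w jw] := ne j.
case: metaM => _ con _ _.
have [||k] := con v w; [by exists i|by exists j|].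
case: k => [|k] /=.
  by move=> e; move: jw; rewrite -e => /(type_inj geoM iv) e'; rewrite e' eqxx in ij.
move=> [z [i' [j' [_ iv' _ [c [Cc cv _]]]]] _].
by exists c => //; rewrite -cv (type_inj geoM iv iv').
Qed.

Lemma on_incident i v x : i != o0 -> elt M i v -> pt x -> x \on v <-> x \in' v.
Proof.
move=> i0 iv px; rewrite (ptsP geoM _ _ iv); first by split=> [[]|].
by apply: contra i0 => /eqP ->; apply/eqP/val_inj.
Qed.

Lemma on_chamber i v x : i != o0 -> elt M i v -> x \on v ->
  exists c, [/\ chamber M c, c o0 = x & c i = v].
Proof.
move=> i0 iv xv; have px := pts_pt xv; move/(on_incident i0 iv px): xv.
by move/(incident_chamber geoM) => h; apply: (h o0 i) => //;
  [rewrite eq_sym|rewrite -points_o0].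
Qed.

Lemma elt_point i v : elt M i v -> exists x, x \on v.
Proof.
move=> /elt_in_chamber[c Cc <-]; exists (c o0).
apply: (chamber_sub Cc (_ : o0 <= i)) => //; split; last by left.
by rewrite points_o0; apply: chamber_elt.
Qed.

Lemma plane_line_on P x : pl P -> x \on P ->
  exists L, [/\ ln L, x \on L & pts M L `<=` pts M P].
Proof.
move=> pP xP; have [c [Cc c0 c2]] := on_chamber (isT : o2 != o0) pP xP.
exists (c o1); split; first exact: chamber_elt.
  apply: (chamber_sub Cc (isT : o0 <= o1)); rewrite c0.
  by split; [apply: pts_pt xP|left].
by rewrite -c2; apply: chamber_sub.
Qed.

Lemma plane_symp_incident P S : pl P -> sy S ->
  P \in' S <-> pts M P `<=` pts M S.
Proof.
move=> pP sS; rewrite (incident_chamber geoM (_ : o2 != o3) pP sS) //.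
split=> [[c [Cc <- <-]]|PS]; first exact: chamber_sub.
have [x xP] := elt_point pP; have [L [lL xL LP]] := plane_line_on pP xP.
by exists (flag x L P S); split=> //; apply: flag_chamber.
Qed.

(** The inclusion of the point set of a line in that of a symp does not
    directly give a chamber, which also needs a plane in between; that such a
    plane exists is shown in line_symp. *)
Lemma line_symp_incident L S : ln L -> sy S ->
  L \in' S <->
  exists P, [/\ pl P, pts M L `<=` pts M P & pts M P `<=` pts M S].
Proof.
move=> lL sS; rewrite (incident_chamber geoM (_ : o1 != o3) lL sS) //.
split=> [[c [Cc <- <-]]|[P [pP LP PS]]].
  by exists (c o2); split; [apply: chamber_elt|apply: chamber_sub..].
have [x xL] := elt_point lL.
by exists (flag x L P S); split=> //; apply: flag_chamber.
Qed.

Lemma line_symp_sub L S : ln L -> sy S -> L \in' S -> pts M L `<=` pts M S.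
Proof. by move=> lL sS /(line_symp_incident lL sS)[P [_ LP PS] y /LP/PS]. Qed.

Section Shadow.
Variable S : T.
Hypothesis sS : sy S.

Definition sh : pregeometry T 3 := shadow M o3 S.

Lemma sh_polar : polar_space3 sh.
Proof. by case: metaM => _ _ _ [h _ _]; apply: h. Qed.

Let geo_sh : is_geometry sh. Proof. by case: sh_polar. Qed.

Lemma sh_elt (j : 'I_3) (i : 'I_4) v : j = i :> nat ->
  elt sh j v <-> elt M i v /\ v \in' S.
Proof. by move=> ji; rewrite (_ : i = @below 4 o3 j) //; apply: val_inj. Qed.

Lemma sh_points x : points sh x <-> x \on S.
Proof.
apply: (iff_trans (@sh_elt ord0 o0 x erefl)); rewrite -points_o0; split=> [[px xS]|xS].
  by apply/(on_incident (isT : o3 != o0) sS px).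
have px := pts_pt xS.
by split=> //; apply/(on_incident (isT : o3 != o0) sS px).
Qed.

Lemma sh_lines L : lines sh L <-> ln L /\ L \in' S.
Proof. exact: sh_elt. Qed.

Lemma sh_planes P : planes sh P <-> pl P /\ pts M P `<=` pts M S.
Proof.
apply: (iff_trans (@sh_elt (@Ordinal 3 2 isT) o2 P erefl)); split=> -[pP PS]; split=> //.
  by apply/(plane_symp_incident pP sS).
by apply/(plane_symp_incident pP sS).
Qed.

Lemma sh_chamber c : chamber M c -> c o3 = S ->
  chamber sh (fun j : 'I_3 => c (@below 4 o3 j)).
Proof. by move=> Cc c3; exists c. Qed.

Lemma sh_pts_line L : lines sh L -> pts sh L = pts M L.
Proof.
move=> shL; have [lL /(line_symp_incident lL sS)[P [pP LP PS]]] := (sh_lines L).1 shL.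
apply/seteqP; split=> x.
  move=> /(ptsP geo_sh _ (isT : @Ordinal 3 1 isT != ord0) shL)[shx].
  move/(incident_chamber geo_sh (isT : ord0 != @Ordinal 3 1 isT) shx shL).
  move=> [_ [[d [Cd d3 ->]] /= d0 d1]].
  have dP : d (@below 4 o3 ord0) \on d (@below 4 o3 ord0).
    split; last by left.
    by rewrite points_o0 (_ : o0 = @below 4 o3 ord0);
      [apply: chamber_elt|apply: val_inj].
  have := chamber_sub Cd (_ : @below 4 o3 ord0 <= @below 4 o3 (@Ordinal 3 1 isT)) dP.
  by rewrite d0 d1; apply.
move=> xL; have px := pts_pt xL.
have shx : points sh x by apply/sh_points/PS/LP.
apply/(ptsP geo_sh _ (isT : @Ordinal 3 1 isT != ord0) shL); split=> //.
apply/(incident_chamber geo_sh (isT : ord0 != @Ordinal 3 1 isT) shx shL).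
exists (fun j : 'I_3 => flag x L P S (@below 4 o3 j)); split=> //.
by apply: sh_chamber => //; apply: flag_chamber.
Qed.

Lemma sh_pts_plane P : planes sh P -> pts sh P = pts M P.
Proof.
move=> shP; have [pP PS] := (sh_planes P).1 shP.
apply/seteqP; split=> x.
  move=> /(ptsP geo_sh _ (isT : @Ordinal 3 2 isT != ord0) shP)[shx].
  move/(incident_chamber geo_sh (isT : ord0 != @Ordinal 3 2 isT) shx shP).
  move=> [_ [[d [Cd d3 ->]] /= d0 d1]].
  have dP : d (@below 4 o3 ord0) \on d (@below 4 o3 ord0).
    split; last by left.
    by rewrite points_o0 (_ : o0 = @below 4 o3 ord0);
      [apply: chamber_elt|apply: val_inj].
  have := chamber_sub Cd (_ : @below 4 o3 ord0 <= @below 4 o3 (@Ordinal 3 2 isT)) dP.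
  by rewrite d0 d1; apply.
move=> xP; have px := pts_pt xP; have [L [lL xL LP]] := plane_line_on pP xP.
have shx : points sh x by apply/sh_points/PS.
apply/(ptsP geo_sh _ (isT : @Ordinal 3 2 isT != ord0) shP); split=> //.
apply/(incident_chamber geo_sh (isT : ord0 != @Ordinal 3 2 isT) shx shP).
exists (fun j : 'I_3 => flag x L P S (@below 4 o3 j)); split=> //.
by apply: sh_chamber => //; apply: flag_chamber.
Qed.

End Shadow.

Section Residue.
Variable x : T.
Hypothesis px : pt x.

(** The residue at x is a dual polar space; in its dual, the symps on x are the
    points, the planes on x the lines, and the lines on x the planes. So all
    inclusions are reversed. *)
Definition rs : pregeometry T 3 := dual (residue M o0 x).

Lemma rs_polar : polar_space3 rs.
Proof. by case: metaM => _ _ _ [_ h _]; apply: h. Qed.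

Let geo_rs : is_geometry rs. Proof. by case: rs_polar. Qed.

Lemma rs_elt (j : 'I_3) (i : 'I_4) v : (i + j = 3)%N -> i != o0 ->
  elt rs j v <-> elt M i v /\ x \on v.
Proof.
move=> ij i0; have -> : i = @above 4 o0 (rev_ord j).
  apply: val_inj; case: i i0 ij => -[|[|[|[|//]]]] h //= _;
  by case: j => -[|[|[|//]]] h'.
split=> -[h1 h2]; split=> //.
  by apply/(on_incident _ h1 px).
by move/(on_incident _ h1 px): h2; apply.
Qed.

Lemma rs_points S : points rs S <-> sy S /\ x \on S.
Proof. exact: rs_elt. Qed.

Lemma rs_lines P : lines rs P <-> pl P /\ x \on P.
Proof. exact: rs_elt. Qed.

Lemma rs_planes L : planes rs L <-> ln L /\ x \on L.
Proof. exact: rs_elt. Qed.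

Lemma rs_chamber d (j : 'I_3 -> 'I_4) : (forall i, j i + i = 3)%N ->
  chamber M d -> d o0 = x -> chamber rs (fun i => d (j i)).
Proof.
move=> ji Cd d0; exists d; split=> //; apply/funext => i /=; congr d.
by apply: val_inj => /=; apply/eqP; rewrite -(eqn_add2r (rev_ord i)) ji /=;
  case: i => -[|[|[]]].
Qed.

Lemma rs_incident (i j : 'I_3) (i' j' : 'I_4) v w :
  i != j -> (i' + i = 3)%N -> (j' + j = 3)%N ->
  elt rs i v -> elt rs j w ->
  incident rs v w <-> exists d, [/\ chamber M d, d o0 = x, d i' = v & d j' = w].
Proof.
move=> ij ii jj iv jw; rewrite (incident_chamber geo_rs ij iv jw).
have inI k : 3 - k < 4 by rewrite ltnS leq_subr.
split=> [[c [[d [Cd d0 ec]] cv cw]]|[d [Cd d0 dv dw]]].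
  have cd (k : 'I_3) (k' : 'I_4) : (k' + k = 3)%N -> d k' = c k.
    move=> kk; rewrite -[in RHS](rev_ordK k).
    move/(congr1 (fun f => f (rev_ord k))): ec => /= ->.
    congr d; apply: val_inj; case: k' kk => -[|[|[|[|//]]]] h /=;
    by case: k => -[|[|[|//]]] h'.
  by exists d; split=> //; [rewrite -cv|rewrite -cw]; apply: cd.
exists (fun k => d (Ordinal (inI k))); split.
- apply: (@rs_chamber d (fun k : 'I_3 => Ordinal (inI k))) => // k /=.
  by rewrite subnK // ltnW.
- by rewrite -dv; congr d; apply: val_inj => /=; apply/eqP; rewrite -(eqn_add2r i) subnK ?ii // ltnW.
- by rewrite -dw; congr d; apply: val_inj => /=; apply/eqP; rewrite -(eqn_add2r j) subnK ?jj // ltnW.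
Qed.

Lemma rs_pts_line P S : pl P -> x \on P ->
  pts rs P S <-> sy S /\ pts M P `<=` pts M S.
Proof.
move=> pP xP; have rP : lines rs P by apply/rs_lines.
rewrite (ptsP geo_rs _ (isT : @Ordinal 3 1 isT != ord0) rP).
have inc := @rs_incident ord0 (@Ordinal 3 1 isT) o3 o2 S P isT erefl erefl.
split=> [[rS]|[sS PS]].
  move/(inc rS rP) => [d [Cd d0 <- <-]].
  by split; [apply: chamber_elt|apply: chamber_sub].
have rS : points rs S by apply/rs_points; split=> //; apply: PS.
split=> //; apply/(inc rS rP).
have [L [lL xL LP]] := plane_line_on pP xP.
by exists (flag x L P S); split=> //; apply: flag_chamber.
Qed.

Lemma rs_pts_plane L S : ln L -> x \on L ->
  pts rs L S <-> sy S /\ L \in' S.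
Proof.
move=> lL xL; have rL : planes rs L by apply/rs_planes.
rewrite (ptsP geo_rs _ (isT : @Ordinal 3 2 isT != ord0) rL).
have inc := @rs_incident ord0 (@Ordinal 3 2 isT) o3 o1 S L isT erefl erefl.
split=> [[rS]|[sS LS]].
  move/(inc rS rL) => [d [Cd d0 <- <-]]; split; first exact: chamber_elt.
  apply/line_symp_incident; [exact: chamber_elt..|exists (d o2)].
  by split; [apply: chamber_elt|apply: chamber_sub..].
have rS : points rs S by apply/rs_points; split=> //; apply: (line_symp_sub lL).
split=> //; apply/(inc rS rL).
have [P [pP LP PS]] := (line_symp_incident lL sS).1 LS.
by exists (flag x L P S); split=> //; apply: flag_chamber.
Qed.

Lemma rs_line_plane L P : ln L -> x \on L -> pl P -> x \on P ->
  pts rs P `<=` pts rs L <-> pts M L `<=` pts M P.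
Proof.
move=> lL xL pP xP; split=> [sub|LP S].
  have rP : lines rs P by apply/rs_lines.
  have rL : planes rs L by apply/rs_planes.
  have [d [Cd _ <- <-]] : exists d, [/\ chamber M d, d o0 = x, d o2 = P & d o1 = L].
    apply/(@rs_incident (@Ordinal 3 1 isT) (@Ordinal 3 2 isT)) => //.
    by apply: (polar_line_plane_incident rs_polar).
  exact: chamber_sub.
rewrite (rs_pts_line _ pP xP) (rs_pts_plane _ lL xL) => -[sS PS].
by split=> //; apply/(line_symp_incident lL sS); exists P.
Qed.

End Residue.

(** * Points, lines and symps of a metasymplectic space *)

Local Notation "x _|_ y" := (perp M x y) (at level 70).
Local Notation "x ~ y" := (collinear M x y) (at level 70).

Lemma plane_in_symp P : pl P -> exists2 S, sy S & pts M P `<=` pts M S.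
Proof.
move=> /elt_in_chamber[c Cc <-]; exists (c o3); first exact: chamber_elt.
exact: chamber_sub.
Qed.

Lemma line_in_symp L : ln L -> exists2 S, sy S & L \in' S.
Proof.
move=> lL; have [c Cc ec] := elt_in_chamber lL.
exists (c o3); first exact: chamber_elt.
apply/line_symp_incident => //; first exact: chamber_elt.
by exists (c o2); rewrite -ec; split; [apply: chamber_elt|apply: chamber_sub..].
Qed.

Lemma line_avoid L a b : ln L -> exists x, [/\ x \on L, x <> a & x <> b].
Proof.
move=> lL; have [S sS LS] := line_in_symp lL.
have shL : lines (sh S) L by apply/sh_lines.
by rewrite -(sh_pts_line sS shL); apply: (line_avoid2 (sh_polar sS)).
Qed.

(** At a point x of a plane P contained in a line R there would be a line A on
    x in P having a symp in common with R, so that R = A lies in P. *)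
Lemma plane_not_in_line P R : pl P -> ln R -> ~ pts M P `<=` pts M R.
Proof.
move=> pP lR PR; have [x xP] := elt_point pP; have xR := PR _ xP.
have px := pts_pt xP.
have rP : lines (rs x) P by apply/(rs_lines px).
have rR : planes (rs x) R by apply/(rs_planes px).
have [S [A [RS rA AS PA]]] := line_gate (rs_polar px) rP rR.
have [lA xA] := (rs_planes px A).1 rA.
have [sS {}RS] := (rs_pts_plane px S lR xR).1 RS.
have [_ {}AS] := (rs_pts_plane px S lA xA).1 AS.
have {}AP := (rs_line_plane px lA xA pP xP).1 PA.
have [y [yA yx _]] := line_avoid x x lA.
have shA : lines (sh S) A by apply/sh_lines.
have shR : lines (sh S) R by apply/sh_lines.
have AR : A = R.
  apply: (line_uniq (sh_polar sS) shA shR yx); rewrite !sh_pts_line //.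
    exact/PR/AP.
have [S' sS' PS'] := plane_in_symp pP.
have sh'A : lines (sh S') A.
  by apply/sh_lines; split=> //; apply/line_symp_incident => //; exists P.
have sh'P : planes (sh S') P by apply/(sh_planes sS').
apply: (line_neq_plane (sh_polar sS') sh'A sh'P).
rewrite sh_pts_line // sh_pts_plane //; apply/seteqP; split=> //.
by rewrite AR.
Qed.

(** The third case of the intersection axiom is ruled out by plane_not_in_line,
    and a plane containing P in the polar space of S is P. *)
Lemma symps_on_plane S S' P x : sy S -> sy S' -> S <> S' -> pl P ->
  pts M P `<=` pts M S -> pts M P `<=` pts M S' -> x \on S -> x \on S' -> x \on P.
Proof.
move=> sS sS' SS' pP PS PS' xS xS'.
have [y yP] := elt_point pP.
have [L [lL yL LP]] := plane_line_on pP yP.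
case: metaM => _ _ _ [_ _ /(_ S S' sS sS' SS') /= ms3].
have sub : pts M P `<=` pts M S `&` pts M S'.
  by move=> z zP; split; [apply: PS|apply: PS'].
case: ms3 => [e|[z pz e]|[R lR e]|[Q pQ e]].
- by have := sub y yP; rewrite e.
- have [u [uL uz _]] := line_avoid z z lL.
  by have := sub u (LP _ uL); rewrite e.
- by case: (plane_not_in_line pP lR); rewrite -e.
have QS : pts M Q `<=` pts M S by rewrite -e => z [].
have shP : planes (sh S) P by apply/(sh_planes sS).
have shQ : planes (sh S) Q by apply/(sh_planes sS).
have [_ /(_ (pts (sh S) Q))] := plane_maximal (sh_polar sS) shP.
rewrite (sh_pts_plane sS shP) (sh_pts_plane sS shQ) => <-.
- by rewrite -e.
- by rewrite -(sh_pts_plane sS shQ); apply: (plane_singular (sh_polar sS)).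
- by rewrite -e.
Qed.

(** In the polar space at x, the point S is perpendicular to some point of the
    plane L. *)
Lemma adjacent_symp x L S : ln L -> x \on L -> sy S -> x \on S ->
  exists S', [/\ sy S', L \in' S' & S = S' \/
    exists P, [/\ pl P, x \on P, pts M P `<=` pts M S & pts M P `<=` pts M S']].
Proof.
move=> lL xL sS xS; have px := pts_pt xL; have rp := rs_polar px.
have rL : planes (rs x) L by apply/(rs_planes px).
have rS : points (rs x) S by apply/(rs_points px).
have [N [Q [lN NL pQ QS NQ]]] := plane_project rp rS rL.
have [S' [NS' _ _]] := line_avoid2 rp S S lN.
have [sS' LS'] := (rs_pts_plane px S' lL xL).1 (NL _ NS').
exists S'; split=> //.
have [|SS'] := pselect (S = S'); [by left|right].
have [P [rP PS PS' _]] := plane_line rp pQ QS (NQ _ NS') SS'.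
have [pP xP] := (rs_lines px P).1 rP.
have [_ {}PS] := (rs_pts_line px S pP xP).1 PS.
have [_ {}PS'] := (rs_pts_line px S' pP xP).1 PS'.
by exists P.
Qed.

Lemma line_plane_symp S L P x y : sy S -> ln L -> L \in' S -> pl P ->
  pts M P `<=` pts M S -> x \on L -> y \on L -> x <> y -> x \on P -> y \on P ->
  pts M L `<=` pts M P.
Proof.
move=> sS lL LS pP PS xL yL xy xP yP.
have shL : lines (sh S) L by apply/sh_lines.
have shP : planes (sh S) P by apply/(sh_planes sS).
move: xL yL xP yP; rewrite -(sh_pts_line sS shL) -(sh_pts_plane sS shP).
move=> xL yL xP yP.
exact: (singular_line (plane_singular (sh_polar sS) shP) shL xP yP xy xL yL).
Qed.

(** Join L to S by a symp on L meeting S in a plane: the points x and y are in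
    this plane, hence so is L. *)
Lemma two_points_incident L S x y : ln L -> sy S -> x <> y ->
  x \on L -> y \on L -> x \on S -> y \on S -> L \in' S.
Proof.
move=> lL sS xy xL yL xS yS.
have [S' [sS' LS' [->//|[P [pP xP PS PS']]]]] := adjacent_symp lL xL sS xS.
have [->//|SS'] := pselect (S = S').
have LS'' := line_symp_sub lL sS' LS'.
have yP : y \on P by apply: (symps_on_plane sS sS' SS') => //; apply: LS''.
apply/line_symp_incident => //; exists P; split=> //.
exact: (line_plane_symp sS' lL LS' pP PS' xL yL xy xP yP).
Qed.

Lemma line_unique L L' x y : ln L -> ln L' -> x <> y ->
  x \on L -> y \on L -> x \on L' -> y \on L' -> L = L'.
Proof.
move=> lL lL' xy xL yL xL' yL'; have [S sS LS] := line_in_symp lL.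
have LSs := line_symp_sub lL sS LS.
have L'S := two_points_incident lL' sS xy xL' yL' (LSs _ xL) (LSs _ yL).
have shL : lines (sh S) L by apply/sh_lines.
have shL' : lines (sh S) L' by apply/sh_lines.
by apply: (line_uniq (sh_polar sS) shL shL' xy); rewrite sh_pts_line.
Qed.

Lemma line_symp L S : ln L -> sy S -> L \in' S <-> pts M L `<=` pts M S.
Proof.
move=> lL sS; split=> [|LS]; first exact: line_symp_sub.
have [x xL] := elt_point lL; have [y [yL yx _]] := line_avoid x x lL.
by apply: (two_points_incident lL sS yx) => //; apply: LS.
Qed.

Lemma line_sub_symp L S x y : ln L -> sy S -> x <> y ->
  x \on L -> y \on L -> x \on S -> y \on S -> pts M L `<=` pts M S.
Proof.
move=> lL sS xy xL yL xS yS; apply/line_symp => //.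
exact: (two_points_incident lL sS xy).
Qed.

Lemma line_sub_plane L P x y : ln L -> pl P -> x <> y ->
  x \on L -> y \on L -> x \on P -> y \on P -> pts M L `<=` pts M P.
Proof.
move=> lL pP xy xL yL xP yP; have [S sS PS] := plane_in_symp pP.
have LS := two_points_incident lL sS xy xL yL (PS _ xP) (PS _ yP).
exact: (line_plane_symp sS lL LS pP PS xL yL xy).
Qed.

Lemma collinearP x y : x ~ y <->
  x <> y /\ exists L, [/\ ln L, x \on L & y \on L].
Proof.
split=> [[px py xy [L lL [xL yL]]]|[xy [L [lL xL yL]]]].
  by split=> //; exists L; split=> //; apply/(on_incident (isT : o1 != o0) lL).
have px := pts_pt xL; have py := pts_pt yL; split=> //.
by exists L => //; split; apply/(on_incident (isT : o1 != o0) lL).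
Qed.

Lemma line_perp L x y : ln L -> x \on L -> y \on L -> x _|_ y.
Proof.
move=> lL xL yL; have [->|xy] := pselect (x = y); first by left.
by right; apply/collinearP; split=> //; exists L.
Qed.

Lemma sh_perp S x y : sy S -> x \on S -> y \on S -> perp (sh S) x y <-> x _|_ y.
Proof.
move=> sS xS yS; split=> [[->|/(collinear_lineP (sh_polar sS))]|[->|]].
- by left.
- move=> [L [shL]]; have [lL _] := (sh_lines S L).1 shL.
  by rewrite (sh_pts_line sS shL); apply: line_perp.
- by left.
move=> /collinearP[xy [L [lL xL yL]]].
have shL : lines (sh S) L.
  by apply/sh_lines; split=> //; apply: (two_points_incident lL sS xy).
apply: (singular_perp (line_singular (sh_polar sS) shL));
by rewrite sh_pts_line.
Qed.

Lemma sh_linesE L S : sy S -> ln L -> pts M L `<=` pts M S -> lines (sh S) L.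
Proof. by move=> sS lL LS; apply/sh_lines; split=> //; apply/line_symp. Qed.

Lemma symp_project x L S : sy S -> x \on S -> ln L -> pts M L `<=` pts M S ->
  exists y, y \on L /\ x _|_ y.
Proof.
move=> sS xS lL LS; have shL := sh_linesE sS lL LS.
have shx : points (sh S) x by apply/(sh_points sS).
have [[y []]] := one_or_all (sh_polar sS) shx shL.
rewrite (sh_pts_line sS shL) => yL /(sh_perp sS xS (LS _ yL)).
by exists y.
Qed.

Lemma symp_perp_line S L x y y' z : sy S -> x \on S -> ln L ->
  pts M L `<=` pts M S -> y \on L -> y' \on L -> y <> y' ->
  x _|_ y -> x _|_ y' -> z \on L -> x _|_ z.
Proof.
move=> sS xS lL LS yL y'L yy' xy xy' zL; have shL := sh_linesE sS lL LS.
have shx : points (sh S) x by apply/(sh_points sS).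
apply/(sh_perp sS xS (LS _ zL)).
apply: (perp_line (sh_polar sS) shx shL _ _ yy' _ _);
  rewrite ?(sh_pts_line sS shL) //.
- by apply/(sh_perp sS xS (LS _ yL)).
- by apply/(sh_perp sS xS (LS _ y'L)).
Qed.

Lemma plane_perp P x y : pl P -> x \on P -> y \on P -> x _|_ y.
Proof.
move=> pP xP yP; have [S sS PS] := plane_in_symp pP.
have shP : planes (sh S) P by apply/(sh_planes sS).
apply/(sh_perp sS (PS _ xP) (PS _ yP)).
by apply: (perp_collect (sh_polar sS) shP); rewrite sh_pts_plane.
Qed.

Lemma symps_perp S S' x y : sy S -> sy S' -> S <> S' ->
  x \on S -> y \on S -> x \on S' -> y \on S' -> x _|_ y.
Proof.
move=> sS sS' SS' xS yS xS' yS'.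
case: metaM => _ _ _ [_ _ /(_ S S' sS sS' SS') /= ms3].
have xI : (pts M S `&` pts M S') x by [].
have yI : (pts M S `&` pts M S') y by [].
case: ms3 => [e|[z pz e]|[R lR e]|[Q pQ e]]; move: xI yI; rewrite e => //.
- by move=> -> ->; left.
- exact: line_perp.
- exact: plane_perp.
Qed.

(** Once triangles are known to lie in symps, this is the same as being
    perpendicular to two points of L, see perp_joined. *)
Definition joined (x L : T) : Prop :=
  exists P, [/\ pl P, x \on P & pts M L `<=` pts M P].

Lemma joined_perp x L y : joined x L -> y \on L -> x _|_ y.
Proof. by move=> [P [pP xP LP]] yL; apply: (plane_perp pP) => //; apply: LP. Qed.

Lemma symp_joined S L x : sy S -> ln L -> pts M L `<=` pts M S -> x \on S ->
  (forall y, y \on L -> x _|_ y) -> joined x L.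
Proof.
move=> sS lL LS xS xL; have shL := sh_linesE sS lL LS.
have shx : points (sh S) x by apply/(sh_points sS).
have [|P [shP Px LP]] := clique_cons_line (sh_polar sS) shx shL.
  move=> y; rewrite (sh_pts_line sS shL) => yL.
  by apply/(sh_perp sS xS (LS _ yL))/xL.
have [pP _] := (sh_planes sS P).1 shP.
by exists P; rewrite -(sh_pts_plane sS shP) -(sh_pts_line sS shL).
Qed.

(** The residue of a point of N shows that N is in a second plane of a symp S on
    P, as required by lines_meet in the polar space of S. *)
Lemma plane_lines_meet P L N : pl P -> ln L -> ln N ->
  pts M L `<=` pts M P -> pts M N `<=` pts M P -> exists x, x \on L /\ x \on N.
Proof.
move=> pP lL lN LP NP; have [S sS PS] := plane_in_symp pP.
have [x xN] := elt_point lN; have px := pts_pt xN; have rp := rs_polar px.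
have xP := NP _ xN.
have rP : lines (rs x) P by apply/(rs_lines px).
have rN : planes (rs x) N by apply/(rs_planes px).
have PN := (rs_line_plane px lN xN pP xP).2 NP.
have [S' NS' nPS'] := plane_off_line rp rN rP PN.
have rPS : pts (rs x) P S by apply/(rs_pts_line px).
have SS' : S <> S' by move=> e; apply: nPS'; rewrite -e.
have [P' [rP' P'S P'S' P'N]] := plane_line rp rN (PN _ rPS) NS' SS'.
have [pP' xP'] := (rs_lines px P').1 rP'.
have PP' : P <> P' by move=> e; apply: nPS'; rewrite e.
have NP' := (rs_line_plane px lN xN pP' xP').1 P'N.
have [_ {}P'S] := (rs_pts_line px S pP' xP').1 P'S.
have shP : planes (sh S) P by apply/(sh_planes sS).
have shP' : planes (sh S) P' by apply/(sh_planes sS).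
have shL := sh_linesE sS lL (subset_trans LP PS).
have shN := sh_linesE sS lN (subset_trans NP PS).
have := lines_meet (sh_polar sS) shP shP' PP' shN shL.
rewrite (sh_pts_line sS shN) (sh_pts_line sS shL).
rewrite (sh_pts_plane sS shP) (sh_pts_plane sS shP') => /(_ NP NP' LP)[y [yN yL]].
by exists y.
Qed.

(** In the polar space at x, the point S sees a line of the plane xy; that line and
    S span the plane K. *)
Lemma symp_gate S x y : sy S -> x \on S -> x ~ y ->
  exists K, [/\ ln K, x \on K, pts M K `<=` pts M S & joined y K].
Proof.
move=> sS xS /collinearP[xy [A [lA xA yA]]]; have px := pts_pt xS.
have rS : points (rs x) S by apply/(rs_points px).
have rA : planes (rs x) A by apply/(rs_planes px).
have [P [K [rP PA rK KS PK]]] := plane_project (rs_polar px) rS rA.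
have [pP xP] := (rs_lines px P).1 rP; have [lK xK] := (rs_planes px K).1 rK.
have AP := (rs_line_plane px lA xA pP xP).1 PA.
have KP := (rs_line_plane px lK xK pP xP).1 PK.
have [_ /(line_symp lK sS){}KS] := (rs_pts_plane px S lK xK).1 KS.
by exists K; split=> //; exists P; split=> //; apply: AP.
Qed.

(** In the polar space at z, some point S of the plane zy is perpendicular to the
    line P. This gives a line on z in P and S, and it meets N. *)
Lemma plane_gate P N z y : pl P -> ln N -> pts M N `<=` pts M P -> z \on P ->
  z ~ y -> exists S n, [/\ sy S, n \on N, z \on S, n \on S & y \on S].
Proof.
move=> pP lN NP zP /collinearP[zy [B [lB zB yB]]]; have pz := pts_pt zP.
have rP : lines (rs z) P by apply/(rs_lines pz).
have rB : planes (rs z) B by apply/(rs_planes pz).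
have [S [K [BS rK KS PK]]] := line_gate (rs_polar pz) rP rB.
have [lK zK] := (rs_planes pz K).1 rK.
have KP := (rs_line_plane pz lK zK pP zP).1 PK.
have [sS /(line_symp lK _){}KS] := (rs_pts_plane pz S lK zK).1 KS.
have [_ /(line_symp lB sS){}BS] := (rs_pts_plane pz S lB zB).1 BS.
have [n [nN nK]] := plane_lines_meet pP lN lK NP KP.
exists S, n; split=> //; [exact: BS|exact: KS|exact: BS].
Qed.

(** In the polar space at x, the point S is off the plane xa and sees exactly a
    line of it; the point S' of xa is on that line, because S and S' are in the
    plane xb. *)
Lemma symp_gate_mem S S' x a b K : sy S -> sy S' -> x \on S -> b \on S ->
  x ~ b -> x ~ a -> ~ a \on S -> x \on S' -> a \on S' -> b \on S' ->
  ln K -> x \on K -> pts M K `<=` pts M S -> joined a K ->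
  pts M K `<=` pts M S'.
Proof.
move=> sS sS' xS bS xb xa naS xS' aS' bS' lK xK KS [P [pP aP KP]].
have px := pts_pt xS; have xP := KP _ xK.
have [nxa [A [lA xA aA]]] := (collinearP x a).1 xa.
have [nxb [B [lB xB bB]]] := (collinearP x b).1 xb.
have rp := rs_polar px.
have rS : points (rs x) S by apply/(rs_points px).
have rP : lines (rs x) P by apply/(rs_lines px).
have rA : planes (rs x) A by apply/(rs_planes px).
have rB : planes (rs x) B by apply/(rs_planes px).
have rK : planes (rs x) K by apply/(rs_planes px).
have PK := (rs_line_plane px lK xK pP xP).2 KP.
have PA : pts (rs x) P `<=` pts (rs x) A.
  apply/(rs_line_plane px lA xA pP xP).
  exact: (line_sub_plane lA pP nxa xA aA xP aP).
have KS' : pts (rs x) K S.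
  by apply/(rs_pts_plane px) => //; split=> //; apply/line_symp.
have nAS : ~ pts (rs x) A S.
  by move/(rs_pts_plane px S lA xA) => [_ /(line_symp lA sS) h]; apply/naS/h.
have AS' : pts (rs x) A S'.
  apply/(rs_pts_plane px) => //; split=> //.
  exact: (two_points_incident lA sS' nxa).
have perpS : perp (rs x) S S'.
  apply: (perp_collect rp rB); apply/(rs_pts_plane px) => //; split=> //.
    exact: (two_points_incident lB sS nxb).
  exact: (two_points_incident lB sS' nxb).
have /(rs_pts_line px S' pP xP)[_ PS'] : pts (rs x) P S'.
  apply: (perp_traceE rp rS rA nAS rP PA _ AS' perpS) => y Py.
  by apply: (perp_collect rp rK) => //; apply: PK.
exact: subset_trans KP PS'.
Qed.

Definition cosymp (x y : T) : Prop := exists S, [/\ sy S, x \on S & y \on S].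
Definition cosymp3 (x y z : T) : Prop :=
  exists S, [/\ sy S, x \on S, y \on S & z \on S].

(** In the polar space at x, the planes xy and xz meet the plane K in lines. *)
Lemma joined_cosymp3 x y z K : ln K -> x \on K -> joined y K -> joined z K ->
  cosymp3 x y z.
Proof.
move=> lK xK [P [pP yP KP]] [Q [pQ zQ KQ]].
have px := pts_pt xK; have xP := KP _ xK; have xQ := KQ _ xK.
have [xy|xy] := pselect (x = y).
  by have [S sS QS] := plane_in_symp pQ; exists S; rewrite -xy;
    split=> //; apply: QS.
have [xz|xz] := pselect (x = z).
  by have [S sS PS] := plane_in_symp pP; exists S; rewrite -xz;
    split=> //; apply: PS.
have [_ [A [lA xA yA]]] := (collinearP x y).1 (perp_neq xy (plane_perp pP xP yP)).
have [_ [B [lB xB zB]]] := (collinearP x z).1 (perp_neq xz (plane_perp pQ xQ zQ)).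
have rP : lines (rs x) P by apply/(rs_lines px).
have rQ : lines (rs x) Q by apply/(rs_lines px).
have rA : planes (rs x) A by apply/(rs_planes px).
have rB : planes (rs x) B by apply/(rs_planes px).
have rK : planes (rs x) K by apply/(rs_planes px).
have PK := (rs_line_plane px lK xK pP xP).2 KP.
have QK := (rs_line_plane px lK xK pQ xQ).2 KQ.
have PA : pts (rs x) P `<=` pts (rs x) A.
  apply/(rs_line_plane px lA xA pP xP).
  exact: (line_sub_plane lA pP xy xA yA xP yP).
have QB : pts (rs x) Q `<=` pts (rs x) B.
  apply/(rs_line_plane px lB xB pQ xQ).
  exact: (line_sub_plane lB pQ xz xB zB xQ zQ).
have [S [AS BS]] := planes_meet (rs_polar px) rA rK rB rP rQ PA PK QK QB.
have [sS /(line_symp lA _){}AS] := (rs_pts_plane px S lA xA).1 AS.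
have [_ /(line_symp lB sS){}BS] := (rs_pts_plane px S lB xB).1 BS.
by exists S; split=> //; [apply: BS|apply: AS|apply: BS].
Qed.

Lemma line_of x y : x ~ y -> exists L, [/\ ln L, x \on L & y \on L].
Proof. by move=> /collinearP[]. Qed.

Lemma coll_sym x y : x ~ y -> y ~ x. Proof. exact: collinearC. Qed.

Lemma coll_cosymp x y : x ~ y -> cosymp x y.
Proof.
move=> /line_of[L [lL xL yL]]; have [S sS /(line_symp lL sS) LS] := line_in_symp lL.
by exists S; split=> //; apply: LS.
Qed.

Lemma perp_cosymp x y : pt x -> x _|_ y -> cosymp x y.
Proof.
move=> px [<-|]; last exact: coll_cosymp.
have [L [lL xL]] : exists L, ln L /\ x \on L.
  have [c Cc c0] := @elt_in_chamber o0 x (eq_ind _ (fun A => A x) px _ points_o0).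
  exists (c o1); split; first exact: chamber_elt.
  by apply: (chamber_sub Cc (isT : o0 <= o1)); rewrite c0; split=> //; left.
have [S sS /(line_symp lL sS) LS] := line_in_symp lL.
by exists S; split=> //; apply: LS.
Qed.

Lemma cosymp_sym x y : cosymp x y -> cosymp y x.
Proof. by move=> [S []]; exists S. Qed.

Lemma coll_pt x y : x ~ y -> pt x. Proof. by case. Qed.
Lemma coll_neq x y : x ~ y -> x <> y. Proof. by case. Qed.

(** Choose a symp S on xy. If z is not in S, the plane on z and a line K of S
    through x contains a line through z having a symp in common with zy; it
    meets K in some k. The second symp differs from S, which forces k and y to be
    collinear, and then xy and xz are in planes through K. *)
Lemma triangle_symp x y z : x ~ y -> y ~ z -> z ~ x -> cosymp3 x y z.
Proof.
move=> xy yz zx; have [S [sS xS yS]] := coll_cosymp xy.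
have [zS|nzS] := pselect (z \on S); first by exists S.
have [K [lK xK KS [P [pP zP KP]]]] := symp_gate sS xS (coll_sym zx).
have [S0 [k [sS0 kK zS0 kS0 yS0]]] := plane_gate pP lK KP zP (coll_sym yz).
have [kx|xk] := pselect (x = k); first by exists S0; split=> //; rewrite kx.
have SS0 : S <> S0 by move=> e; apply: nzS; rewrite e.
have yk := symps_perp sS sS0 SS0 yS (KS _ kK) yS0 kS0.
have yx : y _|_ x by right; apply: coll_sym.
have jy : joined y K.
  by apply: (symp_joined sS) => // t tK; apply: (symp_perp_line sS yS lK KS xK kK xk).
by apply: (joined_cosymp3 lK xK jy); exists P.
Qed.

Lemma perp_line_symp x L u v : ln L -> u \on L -> v \on L -> u <> v ->
  x _|_ u -> x _|_ v -> exists S, [/\ sy S, x \on S & pts M L `<=` pts M S].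
Proof.
move=> lL uL vL uv xu xv.
have [xL|nxL] := pselect (x \on L).
  have [S sS /(line_symp lL sS) LS] := line_in_symp lL.
  by exists S; split=> //; apply: LS.
have nx t : t \on L -> x <> t by move=> tL e; apply: nxL; rewrite e.
have {}xu := perp_neq (nx _ uL) xu; have {}xv := perp_neq (nx _ vL) xv.
have uvc := perp_neq uv (line_perp lL uL vL).
have [S [sS xS uS vS]] := triangle_symp xu uvc (coll_sym xv).
by exists S; split=> //; apply: (line_sub_symp lL sS uv).
Qed.

Lemma perp_all x L u v w : ln L -> u \on L -> v \on L -> u <> v ->
  x _|_ u -> x _|_ v -> w \on L -> x _|_ w.
Proof.
move=> lL uL vL uv xu xv wL.
have [S [sS xS LS]] := perp_line_symp lL uL vL uv xu xv.
exact: (symp_perp_line sS xS lL LS uL vL uv xu xv wL).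
Qed.

Lemma perp_joined x L u v : ln L -> u \on L -> v \on L -> u <> v ->
  x _|_ u -> x _|_ v -> joined x L.
Proof.
move=> lL uL vL uv xu xv.
have [S [sS xS LS]] := perp_line_symp lL uL vL uv xu xv.
apply: (symp_joined sS) => // y yL.
exact: (symp_perp_line sS xS lL LS uL vL uv xu xv yL).
Qed.

(** If y were not in S, the line K of S on u coplanar with y would have a point k
    collinear to v, and a symp on the triangle y, k, v would contain K. *)
Lemma common_in_symp S u v y : sy S -> u \on S -> v \on S -> ~ u _|_ v ->
  y ~ u -> y ~ v -> y \on S.
Proof.
move=> sS uS vS nuv yu yv; apply: contrapT => nyS; apply: nuv.
have [K [lK uK KS jK]] := symp_gate sS uS (coll_sym yu).
have [k [kK vk]] := symp_project sS vS lK KS.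
have [vek|nvk] := pselect (v = k); first by rewrite vek; apply: (line_perp lK).
have {nvk}vk := perp_neq nvk vk.
have yk : y ~ k.
  by apply: perp_neq (joined_perp jK kK) => e; apply: nyS; rewrite e; apply: KS.
have [S1 [sS1 yS1 kS1 vS1]] := triangle_symp yk (coll_sym vk) (coll_sym yv).
have KS1 := symp_gate_mem sS sS1 (KS _ kK) vS (coll_sym vk) (coll_sym yk) nyS
  kS1 yS1 vS1 lK kK KS jK.
have SS1 : S <> S1 by move=> e; apply: nyS; rewrite e.
exact: (symps_perp sS sS1 SS1 uS vS (KS1 _ uK) vS1).
Qed.

Lemma path_cosymp3 x y z : x ~ y -> y ~ z -> cosymp x z -> cosymp3 x y z.
Proof.
move=> xy yz [S [sS xS zS]]; have [xz|nxz] := pselect (x _|_ z).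
  case: xz => [exz|xz]; last by apply: triangle_symp => //; apply: coll_sym.
  by have [S' [sS' xS' yS']] := coll_cosymp xy; exists S'; rewrite -exz.
by exists S; split=> //; apply: (common_in_symp sS xS zS) => //; apply: coll_sym.
Qed.

Lemma plane_avoid P u : pl P ->
  exists L, [/\ ln L, pts M L `<=` pts M P & ~ u \on L].
Proof.
move=> pP; have [S sS PS] := plane_in_symp pP.
have shP : planes (sh S) P by apply/(sh_planes sS).
have [L [shL]] := plane_line_avoid (sh_polar sS) u shP.
have [lL _] := (sh_lines S L).1 shL.
by rewrite (sh_pts_line sS shL) (sh_pts_plane sS shP); exists L.
Qed.

Lemma line_plane L : ln L -> exists2 P, pl P & pts M L `<=` pts M P.
Proof.
move=> lL; have [S sS /(line_symp_incident lL sS)[P [pP LP _]]] := line_in_symp lL.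
by exists P.
Qed.

Lemma coll_plane x y : x ~ y -> exists P, [/\ pl P, x \on P & y \on P].
Proof.
move=> /line_of[L [lL xL yL]]; have [P pP LP] := line_plane lL.
by exists P; split=> //; apply: LP.
Qed.

(** A line through y in P has a symp in common with yv; applying plane_gate from z
    to this line itself, rather than to an arbitrary one, makes the point k
    serve both gates. *)
Lemma plane_double_gate P y z v x : pl P -> y \on P -> z \on P ->
  y ~ v -> z ~ x -> exists k S S', [/\ k \on P, sy S /\ [/\ y \on S, k \on S & v \on S]
    & sy S' /\ [/\ z \on S', k \on S' & x \on S']].
Proof.
move=> pP yP zP yv zx; have [N [lN NP nyN]] := plane_avoid y pP.
have [S [n [sS nN yS nS vS]]] := plane_gate pP lN NP yP yv.
have yn : y <> n by move=> e; apply: nyN; rewrite e.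
have [L [lL yL nL]] := line_of (perp_neq yn (plane_perp pP yP (NP _ nN))).
have LP := line_sub_plane lL pP yn yL nL yP (NP _ nN).
have LS := line_sub_symp lL sS yn yL nL yS nS.
have [S' [k [sS' kL zS' kS' xS']]] := plane_gate pP lL LP zP zx.
exists k, S, S'; split=> //; first exact: LP.
by split=> //; split=> //; apply: LS.
Qed.

Lemma quadrangle_cosymp_diag z1 z2 x y : x ~ z1 -> z1 ~ y -> x ~ z2 -> z2 ~ y ->
  z1 <> z2 -> z1 _|_ z2 -> cosymp x y.
Proof.
move=> xz1 z1y xz2 z2y nz /(perp_neq nz)/line_of[K [lK z1K z2K]].
have jx : joined x K by apply: (perp_joined lK z1K z2K nz); right.
have jy : joined y K by apply: (perp_joined lK z1K z2K nz); right; apply: coll_sym.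
by have [S [sS _ xS yS]] := joined_cosymp3 lK z1K jx jy; exists S.
Qed.

(** If neither diagonal of the quadrangle is in a symp, replace z1 x by a line k k' of a symp
    on z1 x, where k is in a plane on z1 y; the choice of k puts one diagonal of
    the new quadrangle in a symp, hence the whole quadrangle, and then z1 too. *)
Lemma quadrangle_cosymp z1 z2 x y : x ~ z1 -> z1 ~ y -> x ~ z2 -> z2 ~ y ->
  z1 <> z2 -> cosymp x y.
Proof.
move=> xz1 z1y xz2 z2y nz12.
have [pz|npz] := pselect (z1 _|_ z2).
  exact: (quadrangle_cosymp_diag xz1 z1y xz2 z2y).
have [pxy|npxy] := pselect (x _|_ y); first exact: perp_cosymp (coll_pt xz1) pxy.
apply: contrapT => ncxy.
have ncz : ~ cosymp z1 z2.
  move=> [S [sS z1S z2S]]; apply: ncxy; exists S; split=> //.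
    exact: (common_in_symp sS z1S z2S).
  by apply: (common_in_symp sS z1S z2S) => //; apply: coll_sym.
have [P [pP z1P yP]] := coll_plane z1y.
have [k [S2 [S [kP [sS2 [yS2 kS2 z2S2]] [sS [z1S kS xS]]]]]] :=
  plane_double_gate pP yP z1P (coll_sym z2y) (coll_sym xz1).
have nky : k <> y by move=> e; apply: ncxy; exists S; rewrite -e.
have nkz1 : k <> z1 by move=> e; apply: ncz; exists S2; rewrite -e.
have ky := perp_neq nky (plane_perp pP kP yP).
have kz1 := perp_neq nkz1 (plane_perp pP kP z1P).
have nz2S : ~ z2 \on S by move=> z2S; apply: ncz; exists S.
have nyS : ~ y \on S by move=> yS; apply: ncxy; exists S.
have nkz2 : ~ k _|_ z2.
  move=> [e|kz2]; first by apply: npz; rewrite -e; right; apply: coll_sym.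
  have [[e|kx]|nkx] := pselect (k _|_ x).
  - by apply: npxy; rewrite -e; right.
  - apply: ncxy.
    apply: (quadrangle_cosymp_diag (coll_sym kx) ky xz1 z1y nkz1).
    by right.
  - by apply: nz2S; apply: (common_in_symp sS kS xS nkx); apply: coll_sym.
have [K' [lK' xK' K'S jK']] := symp_gate sS xS xz2.
have [k' [k'K' kk']] := symp_project sS kS lK' K'S.
have z2k' : z2 ~ k'.
  by apply: perp_neq (joined_perp jK' k'K') => e; apply: nz2S; rewrite e; apply: K'S.
have nekk' : k <> k' by move=> e; apply: nkz2; rewrite e; right; apply: coll_sym.
have {}kk' := perp_neq nekk' kk'.
have k'S2 : k' \on S2.
  by apply: (common_in_symp sS2 kS2 z2S2 nkz2); apply: coll_sym.
have [K [lK kK z1K]] := line_of kz1.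
have KS := line_sub_symp lK sS nkz1 kK z1K kS z1S.
have jK : joined y K.
  by exists P; split=> //; apply: (line_sub_plane lK pP nkz1).
have KS2 := symp_gate_mem sS sS2 kS (K'S _ k'K') kk' ky nyS kS2 yS2 k'S2 lK kK KS jK.
by apply: ncz; exists S2; split=> //; apply: KS2.
Qed.

Lemma common_unique z1 z2 x y : ~ cosymp x y ->
  x ~ z1 -> z1 ~ y -> x ~ z2 -> z2 ~ y -> z1 = z2.
Proof.
move=> nc xz1 z1y xz2 z2y; apply: contrapT => nz; apply: nc.
exact: (quadrangle_cosymp xz1 z1y xz2 z2y nz).
Qed.

(** If x and c are in a symp S, a line of S on c coplanar with t has a point
    collinear to x, which is a second common neighbour of x and t. *)
Lemma no_pentagon_cosymp z x y t c : z ~ x -> x ~ y -> y ~ t ->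
  ~ cosymp z y -> ~ cosymp x t -> c ~ z -> c ~ t -> ~ cosymp x c.
Proof.
move=> zx xy yt nzy nxt cz ct [S [sS xS cS]].
have nxc : ~ x _|_ c.
  move=> [e|xc]; first by apply: nxt; rewrite e; apply: coll_cosymp.
  have e : c = y by apply: (common_unique nxt).
  by apply/nzy/coll_cosymp/coll_sym; rewrite -e.
have zS : z \on S by apply: (common_in_symp sS xS cS) => //; apply: coll_sym.
have nyS : ~ y \on S by move=> yS; apply: nzy; exists S.
have ntS : ~ t \on S by move=> tS; apply: nxt; exists S.
have [N [lN cN NS jN]] := symp_gate sS cS ct.
have [m [mN xm]] := symp_project sS xS lN NS.
have tm : t ~ m.
  by apply: perp_neq (joined_perp jN mN) => e; apply: ntS; rewrite e; apply: NS.
have {}xm : x ~ m.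
  by apply: perp_neq xm => e; apply/nxt/coll_cosymp/coll_sym; rewrite e.
have e : m = y by apply: (common_unique nxt) => //; apply: coll_sym.
by apply: nyS; rewrite -e; apply: NS.
Qed.

(** Moving the line xy to a line k k' of a symp on it, with k in a plane on zx
    chosen so that k and c are in a symp, reduces to no_pentagon_cosymp. *)
Lemma no_pentagon z x y t c : z ~ x -> x ~ y -> y ~ t ->
  ~ cosymp z y -> ~ cosymp x t -> c ~ z -> ~ c ~ t.
Proof.
move=> zx xy yt nzy nxt cz ct.
have nxc : ~ cosymp x c by apply: (no_pentagon_cosymp zx xy yt).
have [P [pP zP xP]] := coll_plane zx.
have [k [S' [S [kP [sS' [zS' kS' cS']] [sS [xS kS yS]]]]]] :=
  plane_double_gate pP zP xP (coll_sym cz) xy.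
have nkz : k <> z by move=> e; apply: nzy; exists S; rewrite -e.
have nkx : k <> x by move=> e; apply: nxc; exists S'; rewrite -e.
have kz := perp_neq nkz (plane_perp pP kP zP).
have kx := perp_neq nkx (plane_perp pP kP xP).
have nzS : ~ z \on S by move=> zS; apply: nzy; exists S.
have ntS : ~ t \on S by move=> tS; apply: nxt; exists S.
have [K' [lK' yK' K'S jK']] := symp_gate sS yS yt.
have [k' [k'K' pkk']] := symp_project sS kS lK' K'S.
have tk' : t ~ k'.
  by apply: perp_neq (joined_perp jK' k'K') => e; apply: ntS; rewrite e; apply: K'S.
have nky : ~ k _|_ y.
  move=> [e|ky]; first by apply/nzy/coll_cosymp/coll_sym; rewrite -e.
  by apply: nkx; apply: (common_unique nzy) => //; apply: coll_sym.
have nkk' : k <> k' by move=> e; apply: nky; rewrite e; apply: (line_perp lK').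
have kk' := perp_neq nkk' pkk'.
have [K [lK kK xK]] := line_of kx.
have KS := line_sub_symp lK sS nkx kK xK kS xS.
have KP := line_sub_plane lK pP nkx kK xK kP xP.
have nzk' : ~ cosymp z k'.
  move=> /(path_cosymp3 (coll_sym kz) kk')[S3 [sS3 zS3 kS3 k'S3]].
  have jz : joined z K by exists P.
  have KS3 := symp_gate_mem sS sS3 kS (K'S _ k'K') kk' kz nzS kS3 zS3 k'S3 lK kK KS jz.
  have SS3 : S <> S3 by move=> e; apply: nzS; rewrite e.
  case: (symps_perp sS sS3 SS3 xS (K'S _ k'K') (KS3 _ xK) k'S3) => [e|xk'].
    by apply/nxt/coll_cosymp/coll_sym; rewrite e.
  apply: nky; rewrite (_ : y = k'); first by right.
  by apply: (common_unique nxt) => //; apply: coll_sym.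
have nkt : ~ cosymp k t.
  move=> /(path_cosymp3 kk' (coll_sym tk'))[S3 [sS3 kS3 k'S3 tS3]].
  have K'S3 := symp_gate_mem sS sS3 (K'S _ k'K') kS (coll_sym kk') (coll_sym tk')
    ntS k'S3 tS3 kS3 lK' k'K' K'S jK'.
  have SS3 : S <> S3 by move=> e; apply: ntS; rewrite e.
  exact/nky/(symps_perp sS sS3 SS3 kS yS kS3 (K'S3 _ yK')).
apply: (no_pentagon_cosymp (coll_sym kz) kk' (coll_sym tk') nzk' nkt cz ct).
by exists S'.
Qed.

(** For points in no common symp, this is the opposite of being opposite. *)
Definition close (x y : T) : Prop := exists2 z, x _|_ z & z _|_ y.

Lemma close_sym x y : close x y -> close y x.
Proof. by move=> [z xz zy]; exists z; apply: perpC. Qed.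

Lemma cosymp_close x w y : x ~ w -> cosymp w y -> close x y.
Proof.
move=> xw [S [sS wS yS]].
have [xS|nxS] := pselect (x \on S).
  have [L [lL xL wL]] := line_of xw.
  have LS := line_sub_symp lL sS (coll_neq xw) xL wL xS wS.
  have [m [mL ym]] := symp_project sS yS lL LS.
  by exists m; [apply: (line_perp lL)|apply: perpC].
have [K [lK wK KS jK]] := symp_gate sS wS (coll_sym xw).
have [m [mK ym]] := symp_project sS yS lK KS.
by exists m; [apply: (joined_perp jK)|apply: perpC].
Qed.

Lemma not_close z x y t : z ~ x -> x ~ y -> y ~ t ->
  ~ cosymp z y -> ~ cosymp x t -> ~ close z t.
Proof.
move=> zx xy yt nzy nxt.
have npzt : ~ z _|_ t.
  move=> [e|zt]; first by apply/nzy/coll_cosymp/coll_sym; rewrite e.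
  apply: nxt; rewrite (_ : t = x); last first.
    by apply: (common_unique nzy) => //; apply: coll_sym.
  by apply: perp_cosymp; [case: xy|left].
move=> [c [e|zc] [e'|ct]].
- by apply: npzt; left; rewrite e.
- by apply: npzt; right; rewrite e.
- by apply: npzt; right; rewrite -e'.
- exact: (no_pentagon zx xy yt nzy nxt (coll_sym zc)).
Qed.

(** For x special to y with centre w, closeness of x to a point of a line L on y
    only depends on the angle between L and wy. *)
Lemma close_along_line x w y y1 y2 L : x ~ w -> w ~ y -> ~ cosymp x y ->
  ln L -> y \on L -> y1 \on L -> y2 \on L -> y1 <> y -> close x y1 -> close x y2.
Proof.
move=> xw wy nxy lL yL y1L y2L y1y cl.
have yy1 : y ~ y1 by apply: perp_neq (line_perp lL yL y1L) => e; apply: y1y.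
have cw : cosymp w y1.
  by apply: contrapT => nwy1; apply: (not_close xw wy yy1 nxy nwy1).
have [S [sS wS yS y1S]] := path_cosymp3 wy yy1 cw.
apply: (cosymp_close xw); exists S; split=> //.
exact: (line_sub_symp lL sS y1y).
Qed.

(** Otherwise y is coplanar with the line xz, which lies in a symp on z, x, a; as
    S contains x, a and y, it would contain this line. *)
Lemma cosymp_noncollinear S x a y z : sy S -> a \on S -> x \on S -> y \on S ->
  ~ z \on S -> a ~ x -> x ~ y -> x ~ z -> cosymp z a -> ~ a _|_ y -> ~ z _|_ y.
Proof.
move=> sS aS xS yS nzS ax xy xz cza nay pzy.
have [S' [sS' zS' xS' aS']] := path_cosymp3 (coll_sym xz) (coll_sym ax) cza.
have SS' : S' <> S by move=> e; apply: nzS; rewrite -e.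
have nyS' : ~ y \on S'.
  by move=> yS'; apply/nay/(symps_perp sS' sS SS' aS' yS').
have [K [lK xK zK]] := line_of xz.
have KS' := line_sub_symp lK sS' (coll_neq xz) xK zK xS' zS'.
have jK : joined y K.
  apply: (perp_joined lK xK zK (coll_neq xz)); last exact: perpC.
  by right; apply: coll_sym.
by apply: nzS; apply: (symp_gate_mem sS' sS xS' aS' (coll_sym ax) xy nyS' xS yS aS
  lK xK KS' jK).
Qed.

Lemma symp_triangle S L p q r a c : sy S -> ln L -> pts M L `<=` pts M S ->
  p \on L -> q \on L -> p <> q -> r \on S -> ~ r \on L -> a \on S -> c \on S ->
  p _|_ r -> q _|_ r -> a _|_ p -> a _|_ q -> a _|_ r ->
  c _|_ p -> c _|_ q -> c _|_ r -> a _|_ c.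
Proof.
move=> sS lL LS pL qL pq rS nrL aS cS pr qr ap aq ar cp cq cr.
have shL := sh_linesE sS lL LS.
have shE u v : u \on S -> v \on S -> u _|_ v -> perp (sh S) u v.
  by move=> uS vS; apply: (sh_perp sS uS vS).2.
have pS := LS _ pL; have qS := LS _ qL.
apply/(sh_perp sS aS cS).
apply: (@perp_triangle _ _ (sh_polar sS) p q r a c L) => //;
  by [apply/(sh_points sS)|rewrite (sh_pts_line sS shL)|apply: shE].
Qed.

(** The line K of S on b coplanar with c also lies in S', by symp_gate_mem; the
    centre p of x and c is its point collinear to x. *)
Lemma special_centre x a b c S S' : x ~ a -> a ~ b -> b ~ c -> ~ x _|_ b ->
  ~ cosymp x c -> sy S -> x \on S -> a \on S -> b \on S ->
  sy S' -> a \on S' -> b \on S' -> c \on S' ->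
  exists K p, [/\ ln K, b \on K, p \on K, p <> b & [/\ pts M K `<=` pts M S,
    pts M K `<=` pts M S', joined c K, p ~ x & p ~ c /\ forall t, t \on K -> a _|_ t]].
Proof.
move=> xa ab bc nxb nxc sS xS aS bS sS' aS' bS' cS'.
have ncS : ~ c \on S by move=> cS; apply: nxc; exists S.
have SS' : S <> S' by move=> e; apply: ncS; rewrite e.
have [K [lK bK KS jK]] := symp_gate sS bS bc.
have KS' := symp_gate_mem sS sS' bS aS (coll_sym ab) bc ncS bS' cS' aS' lK bK KS jK.
have [p [pK xp]] := symp_project sS xS lK KS.
have cp : c ~ p.
  by apply: perp_neq (joined_perp jK pK) => e; apply: ncS; rewrite e; apply: KS.
exists K, p; split=> //; first by move=> e; apply: nxb; rewrite -e.
split=> //.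
- apply/coll_sym/perp_neq => // e.
  by apply/nxc/coll_cosymp/coll_sym; rewrite e.
split=> [|t tK]; first exact: coll_sym.
exact: (symps_perp sS sS' SS' aS (KS _ tK) aS' (KS' _ tK)).
Qed.

(** The line of S on q coplanar with y has a point collinear to x, and this is the
    only common neighbour of x and y. *)
Lemma common_in_gate S x y q w : sy S -> x \on S -> q \on S -> q ~ y ->
  ~ cosymp x y -> w ~ x -> w ~ y -> w \on S /\ w _|_ q.
Proof.
move=> sS xS qS qy nxy wx wy.
have nyS : ~ y \on S by move=> yS; apply: nxy; exists S.
have [N [lN qN NS jN]] := symp_gate sS qS qy.
have [m [mN xm]] := symp_project sS xS lN NS.
have ym : y ~ m.
  by apply: perp_neq (joined_perp jN mN) => e; apply: nyS; rewrite e; apply: NS.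
have {}xm : x ~ m.
  by apply: perp_neq xm => e; apply/nxy/coll_cosymp/coll_sym; rewrite e.
have -> : w = m by apply: (common_unique nxy) => //; apply: coll_sym.
by split; [apply: NS|apply: (line_perp lN)].
Qed.

(** If x and y were collinear, y would be the centre of x and c, but that centre is
    collinear to a. *)
Lemma path4_noncollinear x a b c y : x ~ a -> a ~ b -> b ~ c -> c ~ y ->
  ~ x _|_ b -> cosymp x b -> cosymp a c -> ~ cosymp x c -> ~ cosymp a y ->
  ~ x _|_ y.
Proof.
move=> xa ab bc cy nxb cxb cac nxc nay.
have [S [sS xS aS bS]] := path_cosymp3 xa ab cxb.
have [S' [sS' aS' bS' cS']] := path_cosymp3 ab bc cac.
have [K [p [lK bK pK pb [KS KS' jK px [pc aK]]]]] :=
  special_centre xa ab bc nxb nxc sS xS aS bS sS' aS' bS' cS'.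
move=> [e|xy]; first by apply/nay/coll_cosymp/coll_sym; rewrite -e.
apply: nay; rewrite (_ : y = p); last first.
  by apply: (common_unique nxc) => //; apply: coll_sym.
by apply: perp_cosymp (aK _ pK); case: ab.
Qed.

(** Here p and q are the centres of (x, c) and (a, y), and w that of (x, y). As x
    and y are not opposite, no_pentagon puts p and y in a symp, which makes p and
    q collinear; since b, p, q would be a triangle perpendicular to the
    noncollinear points a and c, they are on a line K. This line is in the symps
    S12 and S34 on x, a, b and b, c, y, and so is w. Finally, p = q would be
    coplanar with the line cy, and then plane_gate would put x and a point of cy
    in a symp. *)
Lemma path4_centres x a b c y w L : x ~ a -> a ~ b -> b ~ c -> c ~ y ->
  ~ x _|_ b -> cosymp x b -> ~ a _|_ c -> cosymp a c -> ~ b _|_ y -> cosymp b y ->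
  ~ cosymp x c -> ~ cosymp a y -> ~ cosymp x y ->
  ln L -> c \on L -> y \on L -> (forall n, n \on L -> ~ cosymp x n) ->
  w ~ x -> w ~ y ->
  exists K p q, [/\ ln K, b \on K, p \on K, q \on K & p <> q /\
    [/\ p ~ x /\ p ~ c, q ~ a /\ q ~ y, a _|_ p, c _|_ q
      & [/\ w _|_ p, w _|_ q & w _|_ b]]].
Proof.
move=> xa ab bc cy nxb cxb nac cac nby cby nxc nay nxy lL cL yL nL wx wy.
have [S12 [sS12 xS12 aS12 bS12]] := path_cosymp3 xa ab cxb.
have [S23 [sS23 aS23 bS23 cS23]] := path_cosymp3 ab bc cac.
have [S34 [sS34 bS34 cS34 yS34]] := path_cosymp3 bc cy cby.
have nyb : ~ y _|_ b by move=> h; apply/nby/perpC.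
have nya : ~ cosymp y a by move=> h; apply/nay/cosymp_sym.
have [K [p [lK bK pK pb [KS12 KS23 jK px [pc aK]]]]] :=
  special_centre xa ab bc nxb nxc sS12 xS12 aS12 bS12 sS23 aS23 bS23 cS23.
have [K' [q [lK' bK' qK' qb [K'S34 K'S23 jK' qy [qa cK']]]]] :=
  special_centre (coll_sym cy) (coll_sym bc) (coll_sym ab) nyb nya
    sS34 yS34 cS34 bS34 sS23 cS23 bS23 aS23.
have cpy : cosymp p y.
  apply: contrapT => npy.
  apply: (not_close (coll_sym px) pc cy nxc npy).
  by exists w; right=> //; apply: coll_sym.
have [S5 [sS5 pS5 cS5 yS5]] := path_cosymp3 pc cy cpy.
have nyS23 : ~ y \on S23 by move=> h; apply: nay; exists S23.
have ncq : c <> q by move=> e; apply: nac; right; rewrite e; apply: coll_sym.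
have [N [lN cN qN]] := line_of (perp_neq ncq (cK' _ qK')).
have NS23 := line_sub_symp lN sS23 ncq cN qN cS23 (K'S23 _ qK').
have jN : joined y N.
  by apply: (perp_joined lN cN qN ncq); right => //; apply: coll_sym.
have NS5 := symp_gate_mem sS23 sS5 cS23 (KS23 _ pK) (coll_sym pc) cy nyS23
  cS5 yS5 pS5 lN cN NS23 jN.
have S235 : S23 <> S5 by move=> e; apply: nyS23; rewrite e.
have pq := symps_perp sS23 sS5 S235 (KS23 _ pK) (K'S23 _ qK') pS5 (NS5 _ qN).
have qK : q \on K.
  apply: contrapT => nqK; apply: nac.
  apply: (symp_triangle sS23 lK KS23 pK bK pb (K'S23 _ qK') nqK aS23 cS23) => //.
  - exact: (line_perp lK').
  - exact: aK.
  - exact: aK.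
  - by right; apply: coll_sym.
  - by right; apply: coll_sym.
  - by right; apply: coll_sym.
  - exact: cK'.
have KK' : K = K' by apply: (line_unique lK lK' qb).
have [wS12 wq] := common_in_gate sS12 xS12 (KS12 _ qK) qy nxy wx wy.
have KS34 : pts M K `<=` pts M S34 by rewrite KK'.
have nyx : ~ cosymp y x by move=> h; apply/nxy/cosymp_sym.
have [wS34 wp] := common_in_gate sS34 yS34 (KS34 _ pK) px nyx wy wx.
have S124 : S12 <> S34 by move=> e; apply: nxy; exists S12; split=> //; rewrite e.
exists K, p, q; split=> //; split.
  move=> epq.
  have jL : joined p L.
    apply: (perp_joined lL cL yL (coll_neq cy)); first by right.
    by rewrite epq; right.
  have [P [pP pPP LP]] := jL.
  have [S [n [sS nL' pS nS xS]]] := plane_gate pP lL LP pPP px.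
  by apply: (nL n nL'); exists S.
split=> //; first exact: aK.
  exact: cK'.
split=> //; exact: (symps_perp sS12 sS34 S124).
Qed.

Lemma close_centre x y : pt x -> close x y -> ~ cosymp x y ->
  exists w, w ~ x /\ w ~ y.
Proof.
move=> px [w xw wy] nxy.
have [e|/(fun h => perp_neq h xw) {}xw] := pselect (x = w).
  by case: nxy; apply: perp_cosymp px _; rewrite e.
have [e|/(fun h => perp_neq h wy) {}wy] := pselect (w = y).
  by case: nxy; apply: coll_cosymp; rewrite -e.
by exists w; split=> //; apply: coll_sym.
Qed.

Lemma coll_common x y : x ~ y -> exists z, x ~ z /\ y ~ z.
Proof.
move=> /line_of[L [lL xL yL]]; have [z [zL zx zy]] := line_avoid x y lL.
by exists z; split; apply: perp_neq (line_perp lL _ zL) => // e;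
  [apply: zx|apply: zy].
Qed.

Lemma cosymp_symplectic x y : ~ x _|_ y -> cosymp x y -> symplectic M x y.
Proof.
move=> nxy [S [sS xS yS]]; have px := pts_pt xS; have py := pts_pt yS.
have on v z : sy v -> pt z -> z \on v <-> z \in' v by apply: (@on_incident o3).
split=> //; [by move=> e; apply: nxy; left|by move=> c; apply: nxy; right|].
exists S; split=> [|S' [sS' xS' yS']]; first by split=> //; apply/on.
apply: contrapT => SS'; apply: nxy; apply: (symps_perp sS sS' SS') => //;
  by apply/on.
Qed.

Lemma symplectic_cosymp x y : symplectic M x y -> cosymp x y /\ ~ x _|_ y.
Proof.
move=> [px py xy nxy [S [[sS xS yS] _]]]; split; last by move=> [].
by exists S; split=> //; apply/(@on_incident o3).
Qed.

Lemma symplectic_common x y a : symplectic M x y ->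
  exists z, [/\ z <> a, x ~ z & y ~ z].
Proof.
move=> /symplectic_cosymp[[S [sS xS yS]] nxy].
have shx : points (sh S) x by apply/(sh_points sS).
have shy : points (sh S) y by apply/(sh_points sS).
have shC u v : collinear (sh S) u v -> u ~ v.
  move=> uv; have [uS vS uv' _] := uv.
  apply: perp_neq uv' _; apply/(sh_perp sS); last by right.
    exact/(sh_points sS).
  exact/(sh_points sS).
have [|z [za xz yz]] := noncollinear_common (sh_polar sS) a shx shy.
  by move/(sh_perp sS xS yS).
by exists z; split=> //; apply: shC.
Qed.

End Metasymplectic.

(** * Non-backtracking walks *)

Section Walks.
Variables (T : Type) (V : set T) (R : T -> T -> Prop) (g : nat).
Hypothesis R_sym : forall x y, R x y -> R y x.
Hypothesis R_irr : forall x, ~ R x x.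
Hypothesis R_V : forall x y, R x y -> V x.
Hypothesis girth : forall k f, graph_circuit V R k f -> g <= k.

Definition nbwalk (k : nat) (f : nat -> T) : Prop :=
  (forall i, i < k -> R (f i) (f i.+1)) /\
  (forall i, i.+1 < k -> f i <> f i.+2).

Lemma nbwalk_le k l f : l <= k -> nbwalk k f -> nbwalk l f.
Proof.
by move=> lk [e b]; split=> i il; [apply: e|apply: b]; apply: leq_trans il lk.
Qed.

Lemma nbwalk_shift k l f : nbwalk (k + l) f -> nbwalk l (fun i => f (k + i)).
Proof.
move=> [e b]; split=> i il; rewrite !addnS; [apply: e|apply: b].
  by rewrite ltn_add2l.
by rewrite -addnS ltn_add2l.
Qed.

Lemma nbwalk_eq k f h : (forall i, i <= k -> f i = h i) -> nbwalk k f -> nbwalk k h.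
Proof.
move=> fh [e b]; split=> i il.
  by rewrite -!fh //; [apply: e|apply: ltnW].
by rewrite -!fh //; [apply: b|apply/ltnW/ltnW].
Qed.

Lemma nbwalk_rev k f : nbwalk k f -> nbwalk k (fun i => f (k - i)).
Proof.
move=> [e b]; split=> i il.
  have -> : k - i = (k - i.+1).+1 by lia.
  by apply/R_sym/e; lia.
have -> : k - i = (k - i.+2).+2 by lia.
by move=> e'; apply: (b (k - i.+2)) => //; lia.
Qed.

Lemma nbwalk_cat k l f h : nbwalk k f -> nbwalk l h -> f k = h 0 ->
  (0 < k -> 0 < l -> f k.-1 <> h 1) ->
  nbwalk (k + l) (fun i => if i <= k then f i else h (i - k)).
Proof.
move=> [ef bf] [eh bh] fh turn.
have cE i : k <= i -> (if i <= k then f i else h (i - k)) = h (i - k).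
  move=> ki; have [ik|//] := leqP i k.
  by rewrite (_ : i = k) ?subnn //; lia.
split=> i il.
  have [ik|ki] := ltnP i k; first by rewrite ltnW //; apply: ef.
  rewrite !cE; [|lia..].
  by rewrite subSn //; apply: eh; lia.
have [ik|ki] := ltnP i.+1 k; first by rewrite !ifT //; [apply: bf|lia].
have [ik|{}ki] := ltnP i k.
  have ki' : k = i.+1 by lia.
  rewrite (ltnW ik).
  have -> : i.+2 - k = 1 by lia.
  have -> : i = k.-1 by lia.
  by apply: turn; lia.
rewrite !cE; [|lia..].
have -> : i.+2 - k = (i - k).+2 by lia.
by apply: bh; lia.
Qed.

(** A closed non-backtracking walk contains a circuit: take a repetition with
    minimal gap. *)
Lemma nbwalk_repeat k f i j : nbwalk k f -> i < j -> j <= k -> f i = f j ->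
  g <= j - i.
Proof.
move=> wf; move dE : (j - i) => d; elim/ltn_ind: d i j dE => d IH i j dE ij jk fij.
have [[i' [j' [ii' ij' jj' [ne fe]]]]|none] := pselect (exists i' j',
    [/\ i <= i', i' < j', j' <= j & j' - i' < d /\ f i' = f j']).
  by apply: leq_trans (IH _ ne i' j' erefl ij' (leq_trans jj' jk) fe) (ltnW ne).
have jE : j = i + d by rewrite -dE subnKC // ltnW.
have rpt i' j' : i <= i' -> i' < j' -> j' <= j -> f i' = f j' -> d <= j' - i'.
  move=> ii' ij' jj' e; rewrite leqNgt; apply/negP => lt; apply: none.
  by exists i', j'.
apply: (@girth d (fun n => f (i + n))); split.
- rewrite ltnNge; apply/negP => d2.
  have [d1|d1] : d = 1 \/ d = 2 by lia.
    have jE' : j = i.+1 by lia.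
    by case: (R_irr (x := f i)); rewrite {2}fij jE'; apply: wf.1; lia.
  have jE' : j = i.+2 by lia.
  by case: (wf.2 i); [lia|rewrite -jE'].
- by move=> n nd; apply: (R_V (y := f (i + n).+1)); apply: wf.1; lia.
- move=> m n md nd e; case: (ltngtP m n) => // mn.
    by have := rpt (i + m) (i + n) _ _ _ e; lia.
  by have := rpt (i + n) (i + m) _ _ _ (esym e); lia.
- by move=> n nd; rewrite addnS; apply: wf.1; lia.
- by rewrite -jE addn0.
Qed.

(** Remove common last steps; then the first walk followed by the reverse of the
    second one is closed and non-backtracking, and too short to be nontrivial. *)
Lemma nbwalk_unique m n f h : nbwalk m f -> nbwalk n h -> f 0 = h 0 ->
  f m = h n -> m + n < g -> m = n /\ forall i, i <= m -> f i = h i.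
Proof.
elim: m n => [|m IH] n wf wh e0 e1 mn.
  case: n wh e1 mn => [|n] wh e1 mn.
    by split=> // -[].
  have := nbwalk_repeat wh (ltn0Sn n) (leqnn _); rewrite -e0 e1 => /(_ erefl).
  by rewrite subn0 leqNgt mn.
case: n wh e1 mn => [|n] wh e1 mn.
  have := nbwalk_repeat wf (ltn0Sn m) (leqnn _); rewrite e0 e1 => /(_ erefl).
  by rewrite subn0 leqNgt -(addn0 m.+1) mn.
have [e|ne] := pselect (f m = h n).
  have [|E fh] := IH n (nbwalk_le (leqnSn _) wf) (nbwalk_le (leqnSn _) wh) e0 e.
    by lia.
  rewrite E; split=> // i; rewrite leq_eqVlt => /predU1P[->|]; first by rewrite -E e1 E.
  by rewrite ltnS -E; apply: fh.
have := nbwalk_cat wf (nbwalk_rev wh) _ _.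
rewrite subn0 subSS subn0 => /(_ e1 (fun _ _ => ne)) wc.
have := nbwalk_repeat wc (_ : 0 < m.+1 + n.+1) (leqnn _).
have -> : (m.+1 + n.+1 <= m.+1) = false by lia.
rewrite leq0n e0 (_ : n.+1 - (m.+1 + n.+1 - m.+1) = 0); last by lia.
by move=> /(_ isT erefl); lia.
Qed.

Lemma walk_nbwalk k x y : walk R k x y ->
  exists n f, [/\ n <= k, nbwalk n f, f 0 = x & f n = y].
Proof.
elim: k x => [|k IH] x /=; first by move=> ->; exists 0, (fun=> y); split.
move=> [z Rxz /IH[n [f [nk wf f0 fn]]]].
have [[n0 e]|ne] := pselect (0 < n /\ f 1 = x).
  exists n.-1, (fun i => f (1 + i)); split=> //.
  - by rewrite (leq_trans (leq_pred n)) // (leq_trans nk).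
  - by apply: nbwalk_shift; rewrite add1n prednK.
  - by rewrite add1n prednK.
exists (1 + n), (fun i => if i <= 1 then nth z [:: x; z] i else f (i - 1)); split=> //.
  apply: (@nbwalk_cat 1 n (nth z [:: x; z])) => //.
    by split=> -[] // i; rewrite ltnS.
  by move=> _ n0 e; apply: ne.
by case: n fn {nk wf ne} => [<-//|n] fn /=; rewrite subn1.
Qed.

End Walks.

(** * Generalised octagons *)

Section Octagon.
Variables (T : Type) (O : pregeometry T 2).
Hypothesis octO : generalised_octagon O.

Local Notation inc := (incident O).
Local Notation oline := (@Ordinal 2 1 isT).

Let geoO : is_geometry O. Proof. by case: octO. Qed.

Lemma inc_sym x y : inc x y -> inc y x. Proof. exact: incidentC. Qed.

Lemma inc_irr x : ~ inc x x.
Proof.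
by move=> [i [j [ij ix jx _]]]; move/eqP: ij; apply; apply: (type_inj geoO ix jx).
Qed.

Lemma inc_elements x y : inc x y -> elements O x.
Proof. by move=> [i [j [_ ix _ _]]]; exists i. Qed.

Lemma oct_girth k f : graph_circuit (elements O) inc k f -> 16 <= k.
Proof. by case: octO => _ _ [_ h] _; apply: h. Qed.

Local Notation nbw := (nbwalk inc).

Lemma oct_unique m n f h : nbw m f -> nbw n h -> f 0 = h 0 -> f m = h n ->
  m + n < 16 -> m = n /\ forall i, i <= m -> f i = h i.
Proof. exact: (nbwalk_unique inc_sym inc_irr inc_elements oct_girth). Qed.

Lemma oct_walk x y : elements O x -> elements O y ->
  exists n f, [/\ n <= 8, nbw n f, f 0 = x & f n = y].
Proof.
case: octO => _ [diam _] _ _ Ox Oy; have [k k8 [w _]] := diam x y Ox Oy.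
have [n [f [nk wf f0 fn]]] := walk_nbwalk w.
by exists n, f; split=> //; apply: leq_trans nk k8.
Qed.

Lemma ord2P (i : 'I_2) : i = ord0 \/ i = oline.
Proof. by case: i => -[|[|//]] h; [left|right]; apply: val_inj. Qed.

Lemma inc_points x y : points O x -> inc x y -> lines O y.
Proof.
move=> px [i [j [ij ix jy _]]]; have e := type_inj geoO ix px.
by case: (ord2P j) ij jy => -> //; rewrite e.
Qed.

Lemma inc_lines x y : lines O x -> inc x y -> points O y.
Proof.
move=> lx [i [j [ij ix jy _]]]; have e := type_inj geoO ix lx.
by case: (ord2P j) ij jy => -> //; rewrite e.
Qed.

Lemma nbw_types k f : points O (f 0) -> nbw k f ->
  forall i, i <= k -> if odd i then lines O (f i) else points O (f i).
Proof.
move=> p0 [e _]; elim=> [//|i IH] ik; have := IH (ltnW ik); rewrite /=.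
by have := e i ik; case: (odd i) => /= h t; [apply: inc_lines t h|apply: inc_points t h].
Qed.

Lemma nbw_point k f i : points O (f 0) -> nbw k f -> i <= k -> ~~ odd i ->
  points O (f i).
Proof. by move=> p0 wf ik oi; have := nbw_types p0 wf ik; rewrite (negbTE oi). Qed.

Lemma nbw_line k f i : points O (f 0) -> nbw k f -> i <= k -> odd i ->
  lines O (f i).
Proof. by move=> p0 wf ik oi; have := nbw_types p0 wf ik; rewrite oi. Qed.

Lemma point_line_disjoint x : points O x -> ~ lines O x.
Proof. by move=> px lx; have := type_inj geoO px lx. Qed.

Lemma nbw_odd k f : points O (f 0) -> nbw k f -> lines O (f k) -> odd k.
Proof.
move=> p0 wf lk; apply: contrapT => /negP ok.
exact: point_line_disjoint (nbw_point p0 wf (leqnn k) ok) lk.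
Qed.

Lemma nbw_even k f : points O (f 0) -> nbw k f -> points O (f k) -> ~~ odd k.
Proof.
move=> p0 wf pk; apply/negP => ok.
exact: point_line_disjoint pk (nbw_line p0 wf (leqnn k) ok).
Qed.

Lemma option_avoid (U : Type) (A : set T) (a b : T) :
  `I_2 #<= [set: U] -> A #= [set: option U] -> exists x, [/\ A x, x <> a & x <> b].
Proof.
move=> U2 AU; apply: card3_avoid2; apply: (@card_le_trans _ _ _ [set: option U]).
  have [f fI _] := card_ge_inj U2.
  pose h (i : nat) := if i is i'.+1 then Some (f (inord i')) else None.
  apply/card_leP/injfunPex.
  exists (fun i : `I_3 => SigSub (mem_set (I : [set: option U] (h (val i))))) => //.
  move=> [i i3] [j j3] _ _ /(congr1 val) /= e; apply: val_inj => /=.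
  move: i3 j3 e; rewrite !inE.
  case: i => [|i]; case: j => [|j] //= i3 j3 [/fI/(congr1 val)].
  by rewrite /= !inordK // => ->.
by move/card_eqPle : AU => [].
Qed.

Lemma oct_third x a b : elements O x -> exists y, [/\ inc x y, y <> a & y <> b].
Proof.
case: octO => _ _ _ [s [t [s2 t2 hp hl]]] [i].
case: (ord2P i) => -> ix.
  by have [y [[_ xy] ya yb]] := option_avoid a b t2 (hp x ix); exists y.
have [y [[_ yx] ya yb]] := option_avoid a b s2 (hl x ix).
by exists y; split=> //; apply: inc_sym.
Qed.

Lemma nbw_snoc k f y : nbw k f -> inc (f k) y -> (0 < k -> y <> f k.-1) ->
  nbw k.+1 (fun i => if i <= k then f i else y).
Proof.
move=> wf fy ny; rewrite -(addn1 k).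
apply: (@nbwalk_eq _ _ _ (fun i => if i <= k then f i else nth y [:: f k] (i - k))).
  move=> i ik; case: leqP => // ki.
  by rewrite (_ : i - k = 1) //; lia.
apply: nbwalk_cat => //; last by move=> k0 _ e; apply: ny.
by split=> [[] //|[]].
Qed.

Lemma nbw_cons k f x : nbw k f -> inc x (f 0) -> (0 < k -> x <> f 1) ->
  nbw k.+1 (fun i => if i is j.+1 then f j else x).
Proof.
move=> [e b] xf nx; split=> [[|i] ik //|[|i] ik].
- exact: e.
- exact: nx.
- exact: b.
Qed.

Lemma nbw_extend k f : elements O (f 0) -> nbw k f ->
  exists2 h, nbw k.+1 h & forall i, i <= k -> h i = f i.
Proof.
move=> V0 wf.
have Vk : elements O (f k).
  by case: k wf => [//|k] [e _]; apply/inc_elements/inc_sym/e.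
have [y [fy yk _]] := oct_third (f k.-1) (f k.-1) Vk.
exists (fun i => if i <= k then f i else y); first exact: nbw_snoc.
by move=> i ->.
Qed.

(** An apartment: a closed non-backtracking walk of length 16, as a function of
    period 16 in order that every element of the circuit can serve as origin. *)
Record apartment (h : nat -> T) : Prop := Apartment {
  ap_nbw : forall k, nbw k h;
  ap_per : forall i, h (i + 16) = h i;
  ap_point : points O (h 0) }.

Lemma ap_walk h k l : apartment h -> nbw l (fun i => h (k + i)).
Proof. by move=> ah; apply/nbwalk_shift/ap_nbw. Qed.

Lemma ap_pt h i : apartment h -> ~~ odd i -> points O (h i).
Proof. by move=> ah; apply: (nbw_point (ap_point ah) (ap_nbw ah i) (leqnn i)). Qed.

Lemma ap_ln h i : apartment h -> odd i -> lines O (h i).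
Proof. by move=> ah; apply: (nbw_line (ap_point ah) (ap_nbw ah i) (leqnn i)). Qed.

Lemma ap_shift h k : apartment h -> ~~ odd k -> apartment (fun i => h (k + i)).
Proof.
move=> ah ok; split; [by move=> l; apply: ap_walk|move=> i|].
  by rewrite addnA (ap_per ah).
by rewrite addn0; apply: ap_pt.
Qed.

(** The diameter bounds the length n of a walk g from f 0 to f 9 by 8, parity
    excludes 8, and uniqueness of walks excludes n < 7 as well as a first or last
    step common with f. *)
Lemma far_line f : points O (f 0) -> nbw 9 f -> exists g,
  [/\ nbw 7 g, g 0 = f 0, g 7 = f 9, g 1 <> f 1 & g 6 <> f 8].
Proof.
move=> p0 wf.
have V0 : elements O (f 0) by exists ord0.
have l9 := nbw_line p0 wf (leqnn 9) isT.
have V9 : elements O (f 9) by exists oline.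
have [n [g [n8 wg g0 gn]]] := oct_walk V0 V9.
have on : odd n by apply: (nbw_odd _ wg); rewrite ?g0 // gn.
have n7 : n = 7.
  apply: contrapT => n7; have lt : n + 9 < 16 by lia.
  by have [e _] := oct_unique wg wf g0 gn lt; lia.
rewrite n7 in wg gn; exists g; split=> // e.
  by have [] := oct_unique (nbwalk_shift (k := 1) (l := 6) wg)
    (nbwalk_shift (k := 1) (l := 8) wf) e gn isT.
by have [] := oct_unique (nbwalk_le (isT : 6 <= 7) wg) (nbwalk_le (isT : 8 <= 9) wf) g0 e isT.
Qed.

Lemma apartment_through f : points O (f 0) -> nbw 9 f ->
  exists2 h, apartment h & forall i, i <= 9 -> h i = f i.
Proof.
move=> p0 wf; have [g [wg g0 g7 g1 g6]] := far_line p0 wf.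
have wc := nbwalk_cat wf (nbwalk_rev inc_sym wg) (esym g7) (fun _ _ e => g6 (esym e)).
rewrite /= in wc; set c := (fun i => _) in wc.
have c0 : c 0 = f 0 by [].
have c16 : c 16 = c 0 by rewrite /c /= g0.
have c1 : c 1 <> c 15 by rewrite /c /= => e; apply: g1.
(* c runs along f and returns along g; c1 and c16 take care of the wrap-around. *)
exists (fun i => c (i %% 16)); last first.
  by move=> i i9; rewrite modn_small /c ?i9 //; lia.
split=> [k|i|]; [split=> i _|by rewrite modnDr|by []].
  have [i15|i15] := eqVneq (i %% 16) 15.
    have -> : i.+1 %% 16 = 0 by lia.
    by rewrite i15 -c16; apply: wc.1.
  have -> : i.+1 %% 16 = (i %% 16).+1 by lia.
  by apply: wc.1; lia.
have [i15|i15] := eqVneq (i %% 16) 15.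
  have -> : i.+2 %% 16 = 1 by lia.
  by rewrite i15 => e; apply: c1.
have [i14|i14] := eqVneq (i %% 16) 14.
  have -> : i.+2 %% 16 = 0 by lia.
  by rewrite i14 -c16; apply: wc.2.
have -> : i.+2 %% 16 = (i %% 16).+2 by lia.
by apply: wc.2; lia.
Qed.

Lemma nbw_walk k f : points O (f 0) -> nbw k.*2 f ->
  walk (collinear O) k (f 0) (f k.*2).
Proof.
elim: k f => [//|k IH] f p0 wf /=; exists (f 2); last first.
  have p2 := nbw_point p0 wf (isT : 2 <= k.+1.*2) isT.
  exact: (IH (fun i => f (2 + i)) p2 (nbwalk_shift (k := 2) wf)).
have p2 := nbw_point p0 wf (isT : 2 <= k.+1.*2) isT.
split=> //; first exact: (wf.2 0).
exists (f 1); first exact: (nbw_line p0 wf (isT : 1 <= k.+1.*2) isT).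
by split; [apply: wf.1|apply/inc_sym/wf.1].
Qed.

Lemma walk_incident k x y : walk (collinear O) k x y -> walk inc k.*2 x y.
Proof.
elim: k x => [//|k IH] x /= [z [_ _ _ [L lL [xL zL]]] /IH w].
by exists L => //; exists z => //; apply: inc_sym.
Qed.

Lemma oct_distanceP f k : points O (f 0) -> 0 < k <= 4 -> nbw k.*2 f ->
  forall j, octagon_distance O j (f 0) (f k.*2) <-> j = k.
Proof.
move=> p0 k4 wf j; have wk := nbw_walk p0 wf.
have minw l : l < k -> ~ walk (collinear O) l (f 0) (f k.*2).
  move=> lk /walk_incident w.
  have [n [h [nl wh h0 hn]]] := walk_nbwalk w.
  have lt : n + k.*2 < 16 by lia.
  by have [e _] := oct_unique wh wf h0 hn lt; lia.
split=> [[wj minj]|->]; last by split.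
case: (ltngtP j k) => // jk; first by case: (minw _ jk).
by case: (minj _ jk).
Qed.

Lemma oct_points_walk x y : points O x -> points O y -> x <> y ->
  exists k f, [/\ 0 < k <= 4, nbw k.*2 f, f 0 = x & f k.*2 = y].
Proof.
move=> px py xy.
have [||n [f [n8 wf f0 fn]]] := @oct_walk x y; [by exists ord0|by exists ord0|].
have on : ~~ odd n by apply: (nbw_even _ wf); rewrite ?f0 ?fn.
exists n./2, f; have e : n./2.*2 = n by lia.
rewrite e; split=> //; have [n0|] : n = 0 \/ 0 < n by lia.
  by case: xy; rewrite -f0 -fn n0.
by lia.
Qed.

End Octagon.

(** * Octagons fully embedded in a metasymplectic space *)

Section Embedding.
Variables (T : Type) (M : pregeometry T 4) (O : pregeometry T 2).
Hypothesis metaM : metasymplectic_space M.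
Hypothesis octO : generalised_octagon O.
Hypothesis embO : fully_embedded O M.
Hypothesis dist2 : forall x y, points O x -> points O y -> x <> y ->
  (octagon_distance O 2 x y <-> symplectic M x y).

Let geoM : is_geometry M. Proof. by case: metaM => -[]. Qed.

Local Notation "x _|_ y" := (perp M x y) (at level 70).
Local Notation "x ~ y" := (collinear M x y) (at level 70).
Local Notation "x \on v" := (pts M v x) (at level 70).
Local Notation nbw := (nbwalk (incident O)).
Local Notation cosymp := (cosymp M).
Local Notation close := (close M).

Lemma emb_point x : points O x -> points M x.
Proof. by case: embO => h _ _ _; apply: h. Qed.

Lemma emb_line L : lines O L -> lines M L.
Proof. by case: embO => _ h _ _; apply: h. Qed.

Lemma emb_on x L : lines O L -> x \on L <-> points O x /\ incident O x L.
Proof.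
move=> lL; have lM := emb_line lL; case: embO => _ _ inc full.
have i0 : @Ordinal 4 1 isT != ord0 by [].
split=> [xL|[px xL]].
  have pM := pts_pt xL; have xi := (ptsP geoM x i0 lM).1 xL.
  have px := full x L lL pM xi.2.
  by split=> //; apply/inc => //; case: xi.
by apply/(ptsP geoM x i0 lM); split; [apply: emb_point|apply/inc].
Qed.

Lemma nbw_on k f i : points O (f 0) -> nbw k f -> i < k ->
  if odd i then f i.+1 \on f i else f i \on f i.+1.
Proof.
move=> p0 wf ik; have e := wf.1 i ik.
have hi := nbw_types octO p0 wf (ltnW ik); have hi' := nbw_types octO p0 wf ik.
rewrite /= in hi'; case: (odd i) hi hi' => /= hi hi'; apply/emb_on => //.
by split=> //; apply: inc_sym.
Qed.

Lemma nbw_collinear k f i : points O (f 0) -> nbw k f -> ~~ odd i -> i.+1 < k ->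
  f i ~ f i.+2.
Proof.
move=> p0 wf oi ik; apply/(collinearP metaM); split; first exact: wf.2.
exists (f i.+1); have h1 := nbw_on p0 wf (ltnW ik); have h2 := nbw_on p0 wf ik.
rewrite /= oi in h2; rewrite (negbTE oi) in h1; split=> //.
by apply/emb_line/(nbw_line octO p0 wf (ltnW ik)).
Qed.

(** Condition (S) for the ends of a non-backtracking walk. *)
Lemma walk4_symplectic f : points O (f 0) -> nbw 4 f ->
  cosymp (f 0) (f 4) /\ ~ f 0 _|_ f 4.
Proof.
move=> p0 wf; apply: (symplectic_cosymp metaM).
have p4 := nbw_point octO p0 wf (leqnn 4) isT.
have [|e] := pselect (f 0 <> f 4).
  by move=> /(dist2 p0 p4)[h _]; apply/h/(oct_distanceP octO p0 (isT : 0 < 2 <= 4) wf).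
have {}e : f 0 = f 4 by apply: contrapT.
have w0 : nbw 0 (fun=> f 0) by split.
by have [] := oct_unique octO wf w0 erefl (esym e) isT.
Qed.

Lemma walk_not_symplectic k f : points O (f 0) -> 0 < k <= 4 -> k <> 2 ->
  nbw k.*2 f -> cosymp (f 0) (f k.*2) -> f 0 ~ f k.*2.
Proof.
move=> p0 k4 k2 wf c; have [e|ne] := pselect (f 0 = f k.*2).
  have w0 : nbw 0 (fun=> f 0) by split.
  have lt : k.*2 + 0 < 16 by lia.
  by have [] := oct_unique octO wf w0 erefl (esym e) lt; lia.
apply: contrapT => nc.
have pk := nbw_point octO p0 wf (leqnn _) (negbT (odd_double k)).
apply: k2; apply/esym/(oct_distanceP octO p0 k4 wf)/dist2 => //.
by apply: (cosymp_symplectic metaM) => // -[].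
Qed.

Lemma ap_coll h i : apartment O h -> ~~ odd i -> h i ~ h i.+2.
Proof.
move=> ah oi; apply: (nbw_collinear (ap_point ah) (ap_nbw ah i.+2) oi).
exact: leqnn.
Qed.

Lemma ap_dist2 h i : apartment O h -> ~~ odd i ->
  cosymp (h i) (h (i + 4)) /\ ~ h i _|_ h (i + 4).
Proof.
move=> ah oi; have := @walk4_symplectic (fun j => h (i + j)).
rewrite addn0; apply; first exact: (ap_pt octO).
exact: ap_walk.
Qed.

Lemma walk_rev k f : nbw k f -> nbw k (fun i => f (k - i)).
Proof. exact/nbwalk_rev/inc_sym. Qed.

(** Write b_i for the point f (2i). If b1 and b4 are collinear, then b1, ..., b4
    are in a symp S. The line b0b1 is not in S, as b3 would otherwise be collinear
    to all its points other than b1. So cosymp_noncollinear applies, and by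
    condition (S) the points b0 and b4 are in no common symp. *)
Lemma walk8_shortcut f : points O (f 0) -> nbw 8 f -> f 2 ~ f 8 ->
  ~ cosymp (f 0) (f 8).
Proof.
move=> p0 wf c28 c08.
have pf i (i8 : i <= 8) (oi : ~~ odd i) := nbw_point octO p0 wf i8 oi.
have p2 : points O (f 2) by apply: pf. have p4 : points O (f 4) by apply: pf.
have c02 : f 0 ~ f 2 by apply: (nbw_collinear p0 wf).
have c24 : f 2 ~ f 4 by apply: (nbw_collinear p0 wf).
have c46 : f 4 ~ f 6 by apply: (nbw_collinear p0 wf).
have c68 : f 6 ~ f 8 by apply: (nbw_collinear p0 wf).
have [cs26 n26] := walk4_symplectic (f := fun i => f (2 + i)) p2
  (nbwalk_le (isT : 4 <= 6) (nbwalk_shift (k := 2) wf)).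
have [_ n48] := walk4_symplectic (f := fun i => f (4 + i)) p4
  (nbwalk_shift (k := 4) wf).
have [cs04 n04] := walk4_symplectic p0 (nbwalk_le (isT : 4 <= 8) wf).
have [S [sS S2 S4 S6]] := path_cosymp3 metaM c24 c46 cs26.
have S8 : f 8 \on S by apply: (common_in_symp metaM sS S2 S6 n26); apply: coll_sym.
have lO : lines O (f 1) by apply: (nbw_line octO p0 wf).
have lM := emb_line lO.
have on0 : f 0 \on f 1 := nbw_on p0 wf (isT : 0 < 8).
have on2 : f 2 \on f 1 := nbw_on p0 wf (isT : 1 < 8).
have n02 := coll_neq c02.
have nS0 : ~ f 0 \on S.
  move=> S0; apply: n26.
  have LS := line_sub_symp metaM lM sS n02 on0 on2 S0 S2.
  have perp6 z : z \on f 1 -> z <> f 2 -> f 6 _|_ z.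
    move=> zL z2; have [pz zi] := (emb_on z lO).1 zL.
    have wz : nbw 6 (fun i => if i is j.+1 then f (1 + j) else z).
      apply: (@nbw_cons _ _ 5 (fun j => f (1 + j))) => //.
      exact: (nbwalk_shift (k := 1) (nbwalk_le (isT : 6 <= 8) wf)).
    apply: perpC; right.
    apply: (walk_not_symplectic (k := 3) pz _ _ wz) => //.
    by exists S; split=> //; apply: LS.
  have [z [zL z0 z2]] := line_avoid metaM (f 0) (f 2) lM.
  apply: perpC; apply: (perp_all metaM lM on0 zL _ _ _ on2).
  - by move=> e; apply: z0.
  - exact: perp6.
  - exact: perp6.
have := cosymp_noncollinear metaM sS S4 S2 S8 nS0 (coll_sym c24) c28 (coll_sym c02)
  cs04 n48.
by apply; right; apply: (walk_not_symplectic (k := 4) p0 _ _ wf).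
Qed.

(** If b1 and b4 were collinear, the path b0, b1, b4, b5 would turn outside symps
    at b1 and b4, so that b0 and b5 would be opposite; but b0 and b5 have a
    common neighbour, being at distance 3. *)
Lemma ap_dist3_noncollinear h : apartment O h -> ~ h 2 ~ h 8.
Proof.
move=> ah c28.
have pt i : ~~ odd i -> points O (h i) by apply: (ap_pt octO).
have n08 := walk8_shortcut (pt 0 isT) (ap_nbw ah 8) c28.
have n210 : ~ cosymp (h 2) (h 10).
  move=> c; apply: (@walk8_shortcut (fun i => h (2 + (8 - i)))).
  - exact: pt.
  - exact: (walk_rev (f := fun i => h (2 + i)) (ap_walk _ _ ah)).
  - exact: coll_sym.
  - exact: cosymp_sym.
have c02 := ap_coll ah (isT : ~~ odd 0).
have c810 := ap_coll ah (isT : ~~ odd 8).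
apply: (not_close metaM c02 c28 c810 n08 n210).
have e0 : h 16 = h 0 by rewrite -(ap_per ah 0).
rewrite -e0; apply: close_sym.
have c1012 := ap_coll ah (isT : ~~ odd 10).
apply: (cosymp_close metaM c1012).
exact: (ap_dist2 ah (isT : ~~ odd 12)).1.
Qed.

Lemma walk6_special f : points O (f 0) -> nbw 6 f -> ~ cosymp (f 0) (f 6).
Proof.
move=> p0 wf c.
have c06 := walk_not_symplectic (k := 3) p0 isT (fun e => ltac:(discriminate e)) wf c.
have [f7 w7 e7] := nbw_extend octO (ex_intro _ ord0 p0) wf.
have p07 : points O (f7 0) by rewrite e7.
have [f8 w8 e8] := nbw_extend octO (ex_intro _ ord0 p07) w7.
have p08 : points O (f8 0) by rewrite e8.
have [f9 w9 e9] := nbw_extend octO (ex_intro _ ord0 p08) w8.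
have p09 : points O (f9 0) by rewrite e9.
have [h ah eh] := apartment_through octO p09 w9.
have hE i : i <= 6 -> h i = f i.
  by move=> i6; rewrite eh ?e9 ?e8 ?e7 //; lia.
(* Rotating by 14, that is by -2, makes the walk start at position 2. *)
apply: (ap_dist3_noncollinear (ap_shift octO ah (isT : ~~ odd 14))).
by rewrite -[14 + 2]/(0 + 16) -[14 + 8]/(6 + 16) !(ap_per ah) !hE.
Qed.

Lemma walk8_noncosymp f : points O (f 0) -> nbw 8 f -> ~ cosymp (f 0) (f 8).
Proof.
move=> p0 wf c.
have c08 := walk_not_symplectic (k := 4) p0 isT (fun e => ltac:(discriminate e)) wf c.
have p2 := nbw_point octO p0 wf (isT : 2 <= 8) isT.
have c02 : f 0 ~ f 2 by apply: (nbw_collinear p0 wf).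
have c24 : f 2 ~ f 4 by apply: (nbw_collinear p0 wf).
have c46 : f 4 ~ f 6 by apply: (nbw_collinear p0 wf).
have c68 : f 6 ~ f 8 by apply: (nbw_collinear p0 wf).
have [cs04 n04] := walk4_symplectic p0 (nbwalk_le (isT : 4 <= 8) wf).
have [cs26 n26] := walk4_symplectic (f := fun i => f (2 + i)) p2
  (nbwalk_le (isT : 4 <= 6) (nbwalk_shift (k := 2) wf)).
have s06 := walk6_special p0 (nbwalk_le (isT : 6 <= 8) wf).
have s28 := walk6_special (f := fun i => f (2 + i)) p2 (nbwalk_shift (k := 2) wf).
apply: (path4_noncollinear metaM c02 c24 c46 c68 n04 cs04 cs26 s06 s28).
by right.
Qed.

Lemma ap_dist3 h i : apartment O h -> ~~ odd i -> ~ cosymp (h i) (h (i + 6)).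
Proof.
move=> ah oi; have := @walk6_special (fun j => h (i + j)).
rewrite addn0; apply; first exact: (ap_pt octO).
exact: ap_walk.
Qed.

Lemma ap_dist4 h i : apartment O h -> ~~ odd i -> ~ cosymp (h i) (h (i + 8)).
Proof.
move=> ah oi; have := @walk8_noncosymp (fun j => h (i + j)).
rewrite addn0; apply; first exact: (ap_pt octO).
exact: ap_walk.
Qed.

(** Closeness of opposite vertices of an apartment propagates: it spreads along
    the line b4b5 as seen from b0, along the line b0b1 as seen from a third point
    of b4b5, and along b4b5 as seen from b1. On each of the lines some point is
    special to the observer. *)
Lemma ap_close_step h : apartment O h -> close (h 0) (h 8) -> close (h 2) (h 10).
Proof.
move=> ah cl.
have pt i : ~~ odd i -> points O (h i) by apply: (ap_pt octO).
have e16 : h 16 = h 0 by rewrite -(ap_per ah 0).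
have e17 : h 17 = h 1 by rewrite -(ap_per ah 1).
have lO9 := ap_ln octO ah (isT : odd 9); have l9 := emb_line lO9.
have lO1 := ap_ln octO ah (isT : odd 1); have l1 := emb_line lO1.
have on i := nbw_on (ap_point ah) (ap_nbw ah i.+1) (ltnSn i).
have on8 : h 8 \on h 9 := on 8. have on10 : h 10 \on h 9 := on 9.
have on0 : h 0 \on h 1 := on 0. have on2 : h 2 \on h 1 := on 1.
have [y [yL y8 y10]] := line_avoid metaM (h 8) (h 10) l9.
have [py yi] := (emb_on y lO9).1 yL.
have s0_10 : ~ cosymp (h 0) (h 10).
  rewrite -e16 => c; apply: (ap_dist3 ah (isT : ~~ odd 10)).
  exact: cosymp_sym.
have cl0_10 : close (h 0) (h 10).
  rewrite -e16; apply: close_sym; apply: (cosymp_close metaM (ap_coll ah (isT : ~~ odd 10))).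
  exact: (ap_dist2 ah (isT : ~~ odd 12)).1.
have [w [w0 w10]] := close_centre metaM (emb_point (pt 0 isT)) cl0_10 s0_10.
have cl0y : close (h 0) y.
  apply: (close_along_line metaM (coll_sym w0) w10 s0_10 l9 on10 on8 yL _ cl).
  by move=> e; apply: (ap_nbw ah 10).2 8 _ _.
(* The walk f goes from y around the apartment, back to the line h 17 = h 1; so
   g ends with the point g 6 of h 1 at distance 3 from y. *)
pose f i := if i is j.+1 then h (9 + j) else y.
have wf : nbw 9 f.
  by apply: nbw_cons => //; apply: ap_walk.
have [g [wg g0 g7 _ g6]] := far_line octO (f := f) py wf.
have pg0 : points O (g 0) by rewrite g0.
have wg6 := nbwalk_le (isT : 6 <= 7) wg.
have sy6 : ~ cosymp y (g 6) by rewrite -[y]/(f 0) -g0; apply: walk6_special.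
have cly6 : close y (g 6).
  rewrite -[y]/(f 0) -g0; apply: (cosymp_close metaM).
    exact: (nbw_collinear pg0 wg (isT : ~~ odd 0)).
  have p2 : points O (g 2) by apply: (nbw_point octO pg0 wg).
  by have [] := walk4_symplectic (f := fun i => g (2 + i)) p2
    (nbwalk_shift (k := 2) wg6).
have u1 : g 6 \on h 1.
  have := nbw_on pg0 wg (isT : 6 < 7); rewrite g7 /= /f /=.
  by rewrite -[9 + 8]/17 e17.
have [v [vy vu]] := close_centre metaM (emb_point py) cly6 sy6.
have h0u : h 0 <> g 6 by move=> e; apply: g6; rewrite -e -e16.
have cly2 : close y (h 2).
  exact: (close_along_line metaM (coll_sym vy) vu sy6 l1 u1 on0 on2 h0u (close_sym cl0y)).
have s28 := ap_dist3 ah (isT : ~~ odd 2).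
have cl28 : close (h 2) (h 8).
  apply: (cosymp_close metaM (ap_coll ah (isT : ~~ odd 2))).
  exact: (ap_dist2 ah (isT : ~~ odd 4)).1.
have [t [t2 t8]] := close_centre metaM (emb_point (pt 2 isT)) cl28 s28.
exact: (close_along_line metaM (coll_sym t2) t8 s28 l9 on8 yL on10 y8 (close_sym cly2)).
Qed.

Lemma ap_centres h w : apartment O h -> w ~ h 0 -> w ~ h 8 ->
  exists K p q, [/\ lines M K, h 4 \on K, p \on K, q \on K & p <> q /\
    [/\ p ~ h 0 /\ p ~ h 6, q ~ h 2 /\ q ~ h 8, h 2 _|_ p, h 6 _|_ q
      & [/\ w _|_ p, w _|_ q & w _|_ h 4]]].
Proof.
move=> ah w0 w8.
have c i := ap_coll (i := i) ah; have d2 i := ap_dist2 (i := i) ah.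
have d3 i := ap_dist3 (i := i) ah; have d4 i := ap_dist4 (i := i) ah.
have lO := ap_ln octO ah (isT : odd 7).
have on i := nbw_on (ap_point ah) (ap_nbw ah i.+1) (ltnSn i).
apply: (path4_centres metaM (c 0 isT) (c 2 isT) (c 4 isT) (c 6 isT)
  (d2 0 isT).2 (d2 0 isT).1 (d2 2 isT).2 (d2 2 isT).1 (d2 4 isT).2 (d2 4 isT).1
  (d3 0 isT) (d3 2 isT) (d4 0 isT) (emb_line lO) (on 6) (on 7) _ w0 w8).
move=> n nL; have [pn ni] := (emb_on n lO).1 nL.
have [->|n6] := pselect (n = h 6); first exact: (d3 0 isT).
have wn := nbw_snoc (ap_nbw ah 7) (inc_sym ni) (fun _ => n6).
exact: (walk8_noncosymp (ap_point ah) wn).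
Qed.

(** Let b_i = h (2i), let p_i be the centre of (b_i, b_(i+3)) and w that of
    (b_0, b_4). By ap_centres, w is perpendicular to b_2, and by rotation to b_6,
    so it is also the centre of (b_2, b_6). Hence w is perpendicular to p_1 and
    p_2, and to b_3 on the line p_1p_2. Then w is the centre p_0 of (b_0, b_3), and
    also the centre p_1 of (b_1, b_4), contradicting the fact that p_0 and p_1
    differ. *)
Lemma ap_not_close h : apartment O h -> ~ close (h 0) (h 8).
Proof.
move=> ah cl0; have cl1 := ap_close_step ah cl0.
have ah2 := ap_shift octO ah (isT : ~~ odd 2).
have ah4 := ap_shift octO ah (isT : ~~ odd 4).
have ah8 := ap_shift octO ah (isT : ~~ odd 8).
have cl2 := ap_close_step ah2 cl1.
have pM i (oi : ~~ odd i) := emb_point (ap_pt octO ah oi).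
have d2 i := ap_dist2 (i := i) ah.
have d3 i := ap_dist3 (i := i) ah; have d4 i := ap_dist4 (i := i) ah.
have [w0 [w00 w08]] := close_centre metaM (pM 0 isT) cl0 (d4 0 isT).
have [w1 [w12 w110]] := close_centre metaM (pM 2 isT) cl1 (d4 2 isT).
have [w2 [w24 w212]] := close_centre metaM (pM 4 isT) cl2 (d4 4 isT).
have e16 : h 16 = h 0 by rewrite -(ap_per ah 0).
have [K0 [p0 [p1 [_ _ _ _ [p01 [[p00 p06] [p12 p18] p20 _ [_ w0p1 w0b2]]]]]]] :=
  ap_centres ah w00 w08.
have w016 : w0 ~ h 16 by rewrite e16.
(* w0 is also the centre of (b4, b8), where b8 = b0. *)
have [_ [_ [_ [_ _ _ _ [_ [_ _ _ _ [_ _ w0b6]]]]]]] := ap_centres ah8 w08 w016.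
have [K1 [p1' [p2 [lK1 K1b3 K1p1 K1p2 [p12' [[q12 q18] [p24 p210] _ _ _]]]]]] :=
  ap_centres ah2 w12 w110.
have [_ [p2' [_ [_ _ _ _ [_ [[q24 q210] _ _ _ [w2p2 _ _]]]]]]] :=
  ap_centres ah4 w24 w212.
have w04 : w0 ~ h 4.
  apply: perp_neq w0b2 => e; apply: (d2 0 isT).2; rewrite /= -e.
  by right; apply: coll_sym.
have w012 : w0 ~ h 12.
  by apply: perp_neq w0b6 => e; apply: (d2 8 isT).2; right; rewrite /= -e; apply: coll_sym.
have w02 : w0 = w2.
  by apply: (common_unique metaM (d4 4 isT)) => //; apply: coll_sym.
have e1 : p1' = p1.
  by apply: (common_unique metaM (d3 2 isT)) => //; apply: coll_sym.
have e2 : p2' = p2.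
  by apply: (common_unique metaM (d3 4 isT)) => //; apply: coll_sym.
have w0b3 : w0 _|_ h 6.
  apply: (perp_all metaM lK1 K1p1 K1p2 p12' _ _ K1b3).
    by rewrite e1.
  by rewrite -e2 w02.
have w06 : w0 ~ h 6.
  apply: perp_neq w0b3 => e; apply: (d3 0 isT); apply: (coll_cosymp metaM).
  by rewrite /= -e; apply: coll_sym.
have w0p0 : w0 = p0.
  by apply: (common_unique metaM (d3 0 isT)) => //; apply: coll_sym.
apply: p01.
have h2p0 : h 2 ~ p0.
  by apply: perp_neq p20 => e; apply: (d2 2 isT).2; rewrite e; right.
by apply: (common_unique metaM (d3 2 isT)) => //; rewrite ?w0p0 //;
  [rewrite -w0p0|apply: coll_sym].
Qed.

Lemma walk8_opposite f : points O (f 0) -> nbw 8 f -> ~ close (f 0) (f 8).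
Proof.
move=> p0 wf cl; have [f9 w9 e9] := nbw_extend octO (ex_intro _ ord0 p0) wf.
have p09 : points O (f9 0) by rewrite e9.
have [h ah eh] := apartment_through octO p09 w9.
by apply: (ap_not_close ah); rewrite !eh // !e9.
Qed.

End Embedding.

Theorem theorem3p2 (T : Type) (M : pregeometry T 4) (O : pregeometry T 2) :
  metasymplectic_space M -> generalised_octagon O -> fully_embedded O M ->
  (pseudo_isometric O M <->
   (forall x y : T, points O x -> points O y -> x <> y ->
      (octagon_distance O 2 x y <-> symplectic M x y))).
Proof.
move=> metaM octO embO; split=> [[_ iso] x y px py xy|dist2].
  by have [] := iso x y px py xy.
split=> // x y px py xy.
have [k [f [k4 wf f0 fk]]] := oct_points_walk octO px py xy.
have p0 : points O (f 0) by rewrite f0.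
have := oct_distanceP octO p0 k4 wf; rewrite f0 fk => dE.
have pM : points M x := emb_point embO px.
have pM' : points M y := emb_point embO py.
have close_not_opposite : opposite M x y -> ~ cosymp M x y -> ~ close M x y.
  move=> [_ _ _ none] nc cl; apply: none.
  have [w [wx wy]] := close_centre metaM pM cl nc.
  by exists w; split; apply: collinearC.
have coll i : ~~ odd i -> i.+1 < k.*2 -> collinear M (f i) (f i.+2).
  by move=> oi; apply: (nbw_collinear metaM octO embO p0 wf oi).
suff [c1 c2 c3 c4] : [/\ collinear M x y <-> k = 1, symplectic M x y <-> k = 2,
    special M x y <-> k = 3 & opposite M x y <-> k = 4].
  have sw (P : Prop) j : (P <-> k = j) -> (octagon_distance O j x y <-> P).
    by move=> PE; split=> [/dE e|/PE e]; [apply/PE|apply/dE].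
  by split; apply: sw.
have [k1|[k2|[k3|k4']]] : k = 1 \/ k = 2 \/ k = 3 \/ k = 4 by lia.
- have c : collinear M x y by rewrite -f0 -fk k1; apply: coll; rewrite // k1.
  have [z [xz yz]] := coll_common metaM c.
  rewrite k1; split; split=> //; [by case..|].
  by case=> _ _ _ []; exists z.
- have s : symplectic M x y by apply/(dist2 x y px py xy)/dE.
  have [cs ns] := symplectic_cosymp metaM s.
  have [z [_ xz yz]] := symplectic_common metaM x s.
  rewrite k2; split; split=> //.
  + by move=> c; case: ns; right.
  + move=> [_ _ _ _ [a [_ ua]]]; have [b [ba xb yb]] := symplectic_common metaM a s.
    by case: ba; rewrite -(ua b).
  + by case=> _ _ _ []; exists z.
- have nc : ~ cosymp M x y.
    rewrite -f0 -fk k3; rewrite k3 in wf.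
    exact: (walk6_special metaM octO embO dist2 p0 wf).
  have cl : close M x y.
    rewrite -f0 -fk k3; rewrite k3 in wf coll.
    apply: (cosymp_close metaM (coll 0 isT isT)).
    have p2 := nbw_point octO p0 wf (isT : 2 <= 6) isT.
    by have [] := walk4_symplectic metaM octO dist2
      (f := fun i => f (2 + i)) p2 (nbwalk_shift (k := 2) wf).
  have [w [wx wy]] := close_centre metaM pM cl nc.
  rewrite k3; split; split=> //.
  + by move/(coll_cosymp metaM).
  + by move/(symplectic_cosymp metaM) => [].
  + move=> _; split=> //; first by move/(coll_cosymp metaM).
    exists w; split=> [|z [xz yz]]; first by split; apply: collinearC.
    by apply: (common_unique metaM nc) => //; apply: collinearC.
  + by move=> op; case: (close_not_opposite op nc cl).
- have nc : ~ cosymp M x y.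
    rewrite -f0 -fk k4'; rewrite k4' in wf.
    exact: (walk8_noncosymp metaM octO embO dist2 p0 wf).
  have ncl : ~ close M x y.
    rewrite -f0 -fk k4'; rewrite k4' in wf.
    exact: (walk8_opposite metaM octO embO dist2 p0 wf).
  have none z : collinear M x z -> ~ collinear M y z.
    by move=> xz yz; apply: ncl; exists z; right=> //; apply: collinearC.
  rewrite k4'; split; split=> //.
  + by move/(coll_cosymp metaM).
  + by move/(symplectic_cosymp metaM) => [].
  + by move=> [_ _ _ _ [z [[xz yz] _]]]; case: (none z xz yz).
  + by move=> _; split=> // -[z [xz yz]]; apply: (none z xz yz).
Qed.
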